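(* Let $R$ be a ring, ${}'\mathcal{C}:={}'\mathcal{C}_R$ and $\mathfrak{a}:=\mathrm{ass}_R({}'\mathcal{C})$. Suppose that $\mathrm{udim}({}_RR)<\infty$ and ${}'\mathcal{C}_U\neq\emptyset$ for all uniform left ideals $U$ of $R$. Then: 1. ${}'\mathcal{C}\in\mathrm{Den}_l(R,\mathfrak{a})$ and ${}'Q:={}'\mathcal{C}^{-1}R$ is a semisimple Artinian ring. 2. ${}'Q\simeq Q_{l,\mathrm{cl}}(R/\mathfrak{a})$, an $R$-isomorphism. 3. Let $\pi:R\to R/\mathfrak{a}$, $r\mapsto\overline{r}=r+\mathfrak{a}$, and $\sigma:R\to{}'Q$, $r\mapsto\frac{r}{1}$. Then (a) ${}'\mathcal{C}=\pi^{-1}({}'\mathcal{C}_{R/\mathfrak{a}})\cap{}'\mathcal{C}(R,\mathfrak{a})=\{c\in R\mid\ \cdot\overline{c}_{R/\mathfrak{a}}\text{ and }\cdot c_{\mathfrak{a}}\text{ are injections}\}$ and ${}'\mathcal{C}=\sigma^{-1}({}'Q^* )\cap{}'\mathcal{C}(R,\mathfrak{a})$; (b) ${}'\mathcal{C}_{R/\mathfrak{a}}=\mathcal{C}_{R/\mathfrak{a}}=R/\mathfrak{a}\cap{}'Q^*$. 4. For all essential left ideals $I$ of $R$, $I\cap{}'\mathcal{C}\neq\emptyset$. 5. The prime radical $\mathfrak{n}_R$ of $R$ is contained in the ideal $\mathfrak{a}$.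
   Context: Rings are associative with $1$. For a nonempty subset $S$ of a ring $R$, $\mathrm{ass}_R(S):=\{r\in R\mid sr=0\text{ for some }s\in S\}$. ${}'\mathcal{C}_R$ is the set of left regular elements of $R$: those $r\in R$ such that $xr=0$ ($x\in R$) implies $x=0$. $\mathcal{C}_R$ is the set of regular elements: those $r$ such that $xr=0$ implies $x=0$ and $rx=0$ implies $x=0$. For a left ideal $I$ of $R$, ${}'\mathcal{C}_I:=\{i\in I\mid I\to I,\ x\mapsto xi,\text{ is injective}\}$. For an ideal $J$ of $R$ and $r\in R$, $\cdot r_J$ is the map $J\to J$, $y\mapsto yr$, and ${}'\mathcal{C}(R,J):=\{r\in R\mid\ \cdot r_J\text{ is injective}\}$ (so ${}'\mathcal{C}(R,0)=R$). For $c\in R$, $\cdot\overline{c}_{R/\mathfrak{a}}$ is the map $R/\mathfrak{a}\to R/\mathfrak{a}$, $y\mapsto y\overline{c}$, with $\overline{c}=c+\mathfrak{a}$. $A^*$ is the group of units of a ring $A$. A multiplicative set is a subset $S$ with $1\in S$, $SS\subseteq S$, $0\notin S$. It is a left Ore set if $Sr\cap Rs\neq\emptyset$ for all $r\in R$, $s\in S$. It is a left denominator set if it is left Ore and $rs=0$ with $r\in R$, $s\in S$ implies $r\in\mathrm{ass}_R(S)$; then $\mathrm{ass}_R(S)$ is an ideal and the left localization $S^{-1}R$ exists. $\mathrm{Den}_l(R,I)$ is the set of left denominator sets $S$ of $R$ with $\mathrm{ass}_R(S)=I$. $Q_{l,\mathrm{cl}}(A):=\mathcal{C}_A^{-1}A$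 is the classical left quotient ring of $A$ (asserted to exist for $A=R/\mathfrak a$). Since $\ker\sigma=\mathfrak{a}$, $R/\mathfrak{a}$ is regarded as a subring of ${}'Q$. An $R$-isomorphism is a ring isomorphism that is compatible with left multiplication by elements of $R$. A nonzero module is uniform if any two of its nonzero submodules have nonzero intersection; a uniform left ideal is a left ideal that is uniform as a left module. $\mathrm{udim}({}_RR)<\infty$ means that there are finitely many uniform left ideals of $R$ whose sum is direct and is an essential left ideal of $R$. The prime radical is the intersection of all prime ideals. *)

(* Defs.v *)
From HB Require Import structures.
From mathcomp Require Import all_boot all_order all_algebra.
From mathcomp Require Import boolp classical_sets functions.

Set Implicit Arguments.
Unset Strict Implicit.
Unset Printing Implicit Defensive.

Import GRing.Theory.

Local Open Scope classical_set_scope.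
Local Open Scope ring_scope.

Section Ideals.
Variable R : pzRingType.
Implicit Types I J K P : set R.

Definition left_ideal I : Prop :=
  [/\ I 0, forall x y, I x -> I y -> I (x - y) & forall r x, I x -> I (r * x)].

Definition ideal I : Prop := left_ideal I /\ forall r x, I x -> I (x * r).

Definition nonzero_set I : Prop := exists2 x, I x & x != 0.

Definition essential_left_ideal I : Prop :=
  left_ideal I /\
  forall J, left_ideal J -> nonzero_set J -> nonzero_set (I `&` J).

(* The submodules of the left module U are the left ideals of R inside U. *)
Definition uniform_left_ideal (U : set R) : Prop :=
  [/\ left_ideal U, nonzero_set U
    & forall J K, left_ideal J -> left_ideal K -> J `<=` U -> K `<=` U ->
        nonzero_set J -> nonzero_set K -> nonzero_set (J `&` K)].

Definition sum_left_ideals n (U : 'I_n -> set R) : set R :=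
  [set x | exists2 u : 'I_n -> R, (forall i, U i (u i)) & x = \sum_i u i].

Definition direct_left_ideals n (U : 'I_n -> set R) : Prop :=
  forall u : 'I_n -> R, (forall i, U i (u i)) -> \sum_i u i = 0 ->
    forall i, u i = 0.

Definition finite_left_udim : Prop :=
  exists n (U : 'I_n -> set R),
    [/\ forall i, uniform_left_ideal (U i), direct_left_ideals U
      & essential_left_ideal (sum_left_ideals U)].

(* Since P is additively closed, the ideal product JK lies in P iff all the
   products x * y do. *)
Definition prime_ideal P : Prop :=
  [/\ ideal P, ~ P 1
    & forall J K, ideal J -> ideal K ->
        (forall x y, J x -> K y -> P (x * y)) -> J `<=` P \/ K `<=` P].

Definition prime_radical : set R := \bigcap_(P in prime_ideal) P.

Definition minimal_left_ideal (M : set R) : Prop :=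
  [/\ left_ideal M, nonzero_set M
    & forall J, left_ideal J -> nonzero_set J -> J `<=` M -> J = M].

(* The left module R is a direct sum of simple modules; such a sum is finite
   because 1 lies in the sum of finitely many summands. *)
Definition left_semisimple : Prop :=
  exists n (M : 'I_n -> set R),
    [/\ forall i, minimal_left_ideal (M i), direct_left_ideals M
      & sum_left_ideals M = setT].

Definition left_artinian : Prop :=
  forall I : nat -> set R, (forall k, left_ideal (I k)) ->
    (forall k, I k.+1 `<=` I k) ->
    exists n, forall m, (n <= m)%N -> I m = I n.

End Ideals.

(* R^c is the opposite ring, so its left ideals are the right ideals of R. *)
Definition semisimple_artinian (R : pzRingType) : Prop :=
  [/\ left_semisimple R, left_artinian R & left_artinian R^c].

Section Regular.
Variable R : pzRingType.
Implicit Types S I J : set R.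

Definition left_regular : set R := [set r | forall x, x * r = 0 -> x = 0].

Definition regular : set R :=
  [set r | (forall x, x * r = 0 -> x = 0) /\ (forall x, r * x = 0 -> x = 0)].

(* 'C_I *)
Definition left_regular_in I : set R :=
  [set i | I i /\ set_inj I (fun x => x * i)].

(* 'C(R, J) *)
Definition left_regular_on J : set R := [set r | set_inj J (fun y => y * r)].

Definition ring_units : set R := [set u | exists v, v * u = 1 /\ u * v = 1].

Definition ass S : set R := [set r | exists2 s, S s & s * r = 0].

Definition multiplicative S : Prop :=
  [/\ S 1, forall s t, S s -> S t -> S (s * t) & ~ S 0].

Definition left_ore S : Prop :=
  multiplicative S /\
  forall r s, S s -> [set t * r | t in S] `&` [set x * s | x in setT] !=set0.

Definition left_denominator S : Prop :=
  left_ore S /\ forall r s, S s -> r * s = 0 -> ass S r.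

Definition Den_l I : set (set R) := [set S | left_denominator S /\ ass S = I].

End Regular.

Arguments prime_radical R _ : clear implicits.
Arguments left_regular R _ : clear implicits.
Arguments regular R _ : clear implicits.
Arguments ring_units R _ : clear implicits.

(* (Q, sigma) is the left localization S^-1 R: every element of Q has the form
   (sigma s)^-1 * sigma r, and r/1 = 0 iff r is in ass S. *)
Definition is_left_localization (R : pzRingType) (S : set R)
    (Q : pzRingType) (sigma : {rmorphism R -> Q}) : Prop :=
  [/\ forall s, S s -> ring_units Q (sigma s),
      forall q, exists s r, S s /\ sigma s * q = sigma r
    & forall r, sigma r = 0 <-> ass S r].

Section Quotient.
Variables (R : pzRingType) (J : set R) (hJ : ideal J).

Definition ideal_pred of ideal J : {pred R} := fun x => `[< J x >].

Fact ideal_pred_zmod_closed : zmod_closed (ideal_pred hJ).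
Proof.
have [[J0 JB _] _] := hJ; split; first exact/asboolP.
by move=> x y /asboolP Jx /asboolP Jy; apply/asboolP/JB.
Qed.

HB.instance Definition _ :=
  GRing.isZmodClosed.Build R (ideal_pred hJ) ideal_pred_zmod_closed.

Definition quotient_ring := Quotient.quot (ideal_pred hJ).
HB.instance Definition _ := GRing.Zmodule.on quotient_ring.

(* r |-> r + J *)
Definition quotient_proj (x : R) : quotient_ring :=
  \pi_(Quotient.quot (ideal_pred hJ))%qT x.

Definition quotient_one : quotient_ring := quotient_proj 1.

Definition quotient_mul (x y : quotient_ring) : quotient_ring :=
  quotient_proj (repr (x : Quotient.quot (ideal_pred hJ)) *
                 repr (y : Quotient.quot (ideal_pred hJ))).

Lemma quotient_projP x y : quotient_proj x = quotient_proj y <-> J (x - y).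
Proof.
rewrite /quotient_proj; split.
  by move/eqP; rewrite -Quotient.idealrBE => /asboolP.
by move=> Jxy; apply/eqP; rewrite -Quotient.idealrBE; apply/asboolP.
Qed.

Lemma quotient_projK (x : quotient_ring) :
  quotient_proj (repr (x : Quotient.quot (ideal_pred hJ))) = x.
Proof. exact: reprK. Qed.

Lemma quotient_proj_surj (x : quotient_ring) : exists r, x = quotient_proj r.
Proof. by exists (repr (x : Quotient.quot (ideal_pred hJ))); rewrite quotient_projK. Qed.

Lemma quotient_projB : {morph quotient_proj : x y / x - y}.
Proof. by move=> x y; rewrite /quotient_proj raddfB. Qed.

Lemma quotient_projD : {morph quotient_proj : x y / x + y}.
Proof. by move=> x y; rewrite /quotient_proj raddfD. Qed.

Lemma quotient_projM x y :
  quotient_proj (x * y) = quotient_mul (quotient_proj x) (quotient_proj y).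
Proof.
have [[J0 JB Jl] Jr] := hJ.
apply/quotient_projP; set x' := repr _; set y' := repr _.
have Jx : J (x - x') by apply/quotient_projP; rewrite quotient_projK.
have Jy : J (y - y') by apply/quotient_projP; rewrite quotient_projK.
have JN z : J z -> J (- z) by move=> Jz; rewrite -[- z]add0r; apply: JB.
have -> : x * y - x' * y' = (x - x') * y - (- (x' * (y - y'))).
  by rewrite opprK mulrBl mulrBr addrA subrK.
by apply: JB; [apply: Jr | apply/JN/Jl].
Qed.

Fact quotient_mulA : associative quotient_mul.
Proof.
move=> x y z; have [a ->] := quotient_proj_surj x.
have [b ->] := quotient_proj_surj y; have [c ->] := quotient_proj_surj z.
by rewrite -!quotient_projM mulrA.
Qed.

Fact quotient_mul1l : left_id quotient_one quotient_mul.
Proof.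
by move=> x; have [a ->] := quotient_proj_surj x; rewrite -quotient_projM mul1r.
Qed.

Fact quotient_mul1r : right_id quotient_one quotient_mul.
Proof.
by move=> x; have [a ->] := quotient_proj_surj x; rewrite -quotient_projM mulr1.
Qed.

Fact quotient_mulDl : left_distributive quotient_mul +%R.
Proof.
move=> x y z; have [a ->] := quotient_proj_surj x.
have [b ->] := quotient_proj_surj y; have [c ->] := quotient_proj_surj z.
by rewrite -quotient_projD -!quotient_projM mulrDl quotient_projD.
Qed.

Fact quotient_mulDr : right_distributive quotient_mul +%R.
Proof.
move=> x y z; have [a ->] := quotient_proj_surj x.
have [b ->] := quotient_proj_surj y; have [c ->] := quotient_proj_surj z.
by rewrite -quotient_projD -!quotient_projM mulrDr quotient_projD.
Qed.

HB.instance Definition _ := GRing.Zmodule_isPzRing.Build quotient_ring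
  quotient_mulA quotient_mul1l quotient_mul1r quotient_mulDl quotient_mulDr.

HB.instance Definition _ :=
  GRing.isZmodMorphism.Build R quotient_ring quotient_proj quotient_projB.

Fact quotient_proj_monoid : monoid_morphism quotient_proj.
Proof. by split=> // x y; exact: quotient_projM. Qed.

HB.instance Definition _ :=
  GRing.isMonoidMorphism.Build R quotient_ring quotient_proj
    quotient_proj_monoid.

End Quotient.

(* Main.v *)
Require Import Defs.
From HB Require Import structures.
From mathcomp Require Import all_boot all_order all_algebra.
From mathcomp Require Import boolp classical_sets functions.

Set Implicit Arguments.
Unset Strict Implicit.
Unset Printing Implicit Defensive.

Import GRing.Theory.

Local Open Scope classical_set_scope.
Local Open Scope ring_scope.

(** Write C for the set of left regular elements and a for ass C.

    Finite uniform dimension enters through an integer-valued codimension of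
    left ideals.  Fix a direct family of n uniform left ideals U_i with
    essential sum; the codimension of L is the largest number of U_i whose sum
    meets L trivially.  It is at most n, and it grows whenever L is replaced
    by a left ideal L' inside L that is not essential in L
    ([codimension_lt]).  So every nonempty family of left ideals has members
    that are extremal for this relation ([udim_minimal], [udim_maximal]).

    Three consequences drive the localization.  If c is in C then Rc is
    essential, since otherwise the powers of c give an infinite strictly
    decreasing chain ([left_regular_essential]).  Every nonzero left ideal
    contains a uniform one ([uniform_sub]).  Every essential left ideal I
    meets C: among the c in I whose left annihilator meets Rc trivially, one
    with extremal annihilator is left regular, because otherwise a uniform
    U inside I and the annihilator, and an element u of U that acts injectively
    on U, make c + u a better choice ([essential_meets_left_regular]).  The
    Ore condition follows, since for c in C the left ideal of all t with tr in
    Rc is essential.  Left regularity makes the other denominator condition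
    trivial.

    Let Q be a localization of R at C.  Essential left ideals of Q
    restrict to essential left ideals of R, hence contain a unit
    ([localization_no_essential]).  A uniform U either lies in a or meets a
    trivially ([uniform_ass]).  In the first case its extension to Q is zero,
    in the second it is uniform, so Q inherits finite uniform dimension
    ([localization_udim]).  These two properties alone make Q semisimple and
    Artinian on both sides, and they turn left regular elements into units.
    This last fact identifies the left regular, the regular and the Q-invertible
    elements of R/a, so that Q is also the classical quotient ring of R/a.

    For the prime radical, the elements r with rU inside a form a prime ideal
    for every uniform U not inside a ([prime_uniform_ann]).  If x lies in all
    these primes, then x times the sum of the U_i lies in a; that sum contains
    an element c of C, and xc in a forces x in a. *)

(** * Left ideals *)

Section LeftIdeals.
Variable R : pzRingType.
Implicit Types I J K L N U V W : set R.

Lemma lideal0 I : left_ideal I -> I 0. Proof. by case. Qed.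

Lemma lidealB I x y : left_ideal I -> I x -> I y -> I (x - y).
Proof. by case=> _ IB _; exact: IB. Qed.

Lemma lidealM I r x : left_ideal I -> I x -> I (r * x).
Proof. by case=> _ _ IM; exact: IM. Qed.

Lemma lidealN I x : left_ideal I -> I x -> I (- x).
Proof. by move=> hI Ix; rewrite -mulN1r; exact: lidealM. Qed.

Lemma lidealD I x y : left_ideal I -> I x -> I y -> I (x + y).
Proof.
by move=> hI Ix Iy; rewrite -[y]opprK; apply: lidealB => //; exact: lidealN.
Qed.

Lemma lideal_sum (T : finType) (P : pred T) I (f : T -> R) :
  left_ideal I -> (forall i, P i -> I (f i)) -> I (\sum_(i | P i) f i).
Proof.
move=> hI If; apply: (big_ind I) => //; first exact: lideal0.
by move=> x y; exact: lidealD.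
Qed.

Lemma lideal_setI I J : left_ideal I -> left_ideal J -> left_ideal (I `&` J).
Proof.
move=> hI hJ; split=> [|x y [Ix Jx] [Iy Jy]|r x [Ix Jx]].
- by split; exact: lideal0.
- by split; exact: lidealB.
- by split; exact: lidealM.
Qed.

Definition lprincipal x : set R := [set y | exists r, y = r * x].

Lemma lideal_principal x : left_ideal (lprincipal x).
Proof.
split=> [|_ _ [r ->] [s ->]|s _ [r ->]]; first by exists 0; rewrite mul0r.
  by exists (r - s); rewrite mulrBl.
by exists (s * r); rewrite mulrA.
Qed.

Lemma lprincipal_mem x : lprincipal x x.
Proof. by exists 1; rewrite mul1r. Qed.

Lemma lprincipal_nonzero x : x != 0 -> nonzero_set (lprincipal x).
Proof. by exists x => //; exact: lprincipal_mem. Qed.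

Lemma lprincipal_sub I x : left_ideal I -> I x -> lprincipal x `<=` I.
Proof. by move=> hI Ix _ [r ->]; exact: lidealM. Qed.

Definition lsum I J : set R := [set z | exists x y, [/\ I x, J y & z = x + y]].

Lemma lideal_lsum I J : left_ideal I -> left_ideal J -> left_ideal (lsum I J).
Proof.
move=> hI hJ; split=> [|_ _ [x [y [Ix Jy ->]]] [x' [y' [Ix' Jy' ->]]]|].
- by exists 0, 0; split; [exact: lideal0 | exact: lideal0 | rewrite addr0].
- exists (x - x'), (y - y'); split; [exact: lidealB | exact: lidealB |].
  by rewrite opprD addrACA.
- move=> r _ [x [y [Ix Jy ->]]]; exists (r * x), (r * y).
  by split; [exact: lidealM | exact: lidealM | rewrite mulrDr].
Qed.

Lemma lsum_subl I J : left_ideal J -> I `<=` lsum I J.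
Proof.
by move=> hJ x Ix; exists x, 0; split; rewrite ?addr0//; exact: lideal0.
Qed.

Lemma lsum_subr I J : left_ideal I -> J `<=` lsum I J.
Proof.
by move=> hI x Jx; exists 0, x; split; rewrite ?add0r//; exact: lideal0.
Qed.

Definition lann x : set R := [set r | r * x = 0].

Lemma lideal_ann x : left_ideal (lann x).
Proof.
split=> [|r s|s r]; rewrite /lann /= ?mul0r// => rx0.
  by move=> sx0; rewrite mulrBl rx0 sx0 subr0.
by rewrite -mulrA rx0 mulr0.
Qed.

Lemma not_nonzeroP I : ~ nonzero_set I -> forall x, I x -> x = 0.
Proof.
by move=> nI x Ix; apply: contrapT => /eqP x0; apply: nI; exists x.
Qed.

Lemma lideal_colon I x : left_ideal I -> left_ideal [set r | I (r * x)].
Proof.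
move=> hI; split=> [|r s|s r] /=; first by rewrite mul0r; exact: lideal0.
  by move=> Ir Is; rewrite mulrBl; exact: lidealB.
by move=> Ir; rewrite -mulrA; exact: lidealM.
Qed.

Lemma lideal_sumI n (U : 'I_n -> set R) :
  (forall i, left_ideal (U i)) -> left_ideal (sum_left_ideals U).
Proof.
move=> hU; split=> [|_ _ [u Uu ->] [v Uv ->]|r _ [u Uu ->]].
- by exists (fun=> 0); [move=> i; exact: lideal0 | rewrite big1].
- exists (fun i => u i - v i); last by rewrite sumrB.
  by move=> i; exact: lidealB.
- exists (fun i => r * u i); last by rewrite mulr_sumr.
  by move=> i; exact: lidealM.
Qed.

Definition inessential_in L' L : Prop :=
  L' `<=` L /\ exists N,
    [/\ left_ideal N, nonzero_set N, N `<=` L & ~ nonzero_set (N `&` L')].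

(** Pulling back along right multiplication by x: a nonzero J is either killed
    by x, hence inside the colon ideal, or Jx is a nonzero submodule of Rx, to
    which the hypothesis applies. *)
Lemma colon_essential I x :
  left_ideal I ->
  (forall J, left_ideal J -> nonzero_set J -> J `<=` lprincipal x ->
     nonzero_set (J `&` I)) ->
  essential_left_ideal [set r | I (r * x)].
Proof.
move=> hI ess; split; first exact: lideal_colon.
move=> J hJ [j Jj j0].
have [jx0|jx0] := eqVneq (j * x) 0.
  by exists j => //; split=> //=; rewrite jx0; exact: lideal0.
have [] := ess [set y | exists2 r, J r & y = r * x].
- split=> [|_ _ [r Jr ->] [s Js ->]|s _ [r Jr ->]].
  + by exists 0; [exact: lideal0 | rewrite mul0r].
  + by exists (r - s); [exact: lidealB | rewrite mulrBl].
  + by exists (s * r); [exact: lidealM | rewrite mulrA].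
- by exists (j * x) => //; exists j.
- by move=> _ [r _ ->]; exists r.
- move=> _ [[r Jr ->] Irx] rx0; exists r => //.
  by apply: contraNneq rx0 => ->; rewrite mul0r.
Qed.

End LeftIdeals.

(** * Extremal left ideals under finite uniform dimension *)

Lemma exists_max (T : Type) (P : T -> Prop) (g : T -> nat) n :
  (exists x, P x) -> (forall x, g x <= n)%N ->
  exists2 x, P x & forall y, P y -> (g y <= g x)%N.
Proof.
move=> [x0 Px0] gn.
pose A := fun k => `[< exists2 x, P x & g x = k >].
have exA : exists k, A k by exists (g x0); apply/asboolP; exists x0.
have bA k : A k -> (k <= n)%N by move=> /asboolP[x _ <-].
case: (ex_maxnP exA bA) => m /asboolP[x Px <-] max.
by exists x => // y Py; apply: max; apply/asboolP; exists y.
Qed.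

Section FiniteUniformDimension.
Variable R : pzRingType.
Implicit Types I J K L N U V W : set R.

Section Codimension.
Variables (n : nat) (U : 'I_n -> set R).
Hypothesis unifU : forall i, uniform_left_ideal (U i).
Hypothesis directU : direct_left_ideals U.
Hypothesis essU : essential_left_ideal (sum_left_ideals U).

Let lidU i : left_ideal (U i). Proof. by case: (unifU i). Qed.

(** Given x = sum of the u_i in J, multiply x from the left by one ring element
    per index: each moves its u_i into W, by uniformity of U_i, and keeps the
    product nonzero, by directness of the sum.  The final multiple of x lies in
    both J and W. *)
Lemma essential_of_meets W :
  left_ideal W -> (forall i, nonzero_set (W `&` U i)) -> essential_left_ideal W.
Proof.
move=> hW meet; split=> // J hJ nzJ.
have [_ /(_ J hJ nzJ) [x [[u Uu xE] Jx] x0]] := essU.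
suff [r rx0 Wru] : exists2 r, r * x != 0 &
    forall i, i \in enum 'I_n -> W (r * u i).
  exists (r * x) => //; split; last exact: lidealM.
  rewrite xE mulr_sumr; apply: lideal_sum => // i _.
  by apply: Wru; rewrite mem_enum.
elim: (enum 'I_n) => [|i l [r rx0 Wr]]; first by exists 1; rewrite ?mul1r.
have [rui0|rui0] := eqVneq (r * u i) 0.
  exists r => // j; rewrite inE => /orP[/eqP->|]; last exact: Wr.
  by rewrite rui0; exact: lideal0.
have [_ _ uni] := unifU i.
have [| | | | | |_ [[s ->] [Ws _]] s0] :=
    uni (lprincipal (r * u i)) (W `&` U i).
- exact: lideal_principal.
- exact: lideal_setI.
- by apply: lprincipal_sub => //; exact: lidealM.
- by move=> ? [].
- exact: lprincipal_nonzero.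
- exact: meet.
exists (s * r) => [|j].
  apply: contraNneq s0 => srx0; rewrite mulrA.
  apply/eqP; apply: (directU (u := fun j => s * r * u j)) => [k|].
    exact: lidealM.
  by rewrite -mulr_sumr -xE.
rewrite inE -mulrA => /orP[/eqP->//|lj].
by apply: lidealM => //; exact: Wr.
Qed.

Definition partial_sum (B : {set 'I_n}) : set R :=
  [set x | exists u : 'I_n -> R,
     [/\ forall i, U i (u i), forall i, i \notin B -> u i = 0 & x = \sum_i u i]].

Lemma lideal_partial_sum B : left_ideal (partial_sum B).
Proof.
split=> [|_ _ [u [Uu u0 ->]] [v [Uv v0 ->]]|r _ [u [Uu u0 ->]]].
- by exists (fun=> 0); split=> //; [move=> i; exact: lideal0 | rewrite big1].
- exists (fun i => u i - v i); split=> [i|i iB|]; last by rewrite sumrB.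
    exact: lidealB.
  by rewrite u0 ?v0 ?subr0.
- exists (fun i => r * u i); split=> [i|i iB|]; last by rewrite mulr_sumr.
    exact: lidealM.
  by rewrite u0 ?mulr0.
Qed.

Definition avoids L (B : {set 'I_n}) : Prop :=
  ~ nonzero_set (L `&` partial_sum B).

Definition codimension L : nat :=
  \max_(B : {set 'I_n} | `[< avoids L B >]) #|B|.

Lemma avoids_codimension L : left_ideal L ->
  exists2 B, avoids L B & codimension L = #|B|.
Proof.
move=> hL; have av0 : `[< avoids L finset.set0 >].
  apply/asboolP => -[_ [_ [u [_ u0 ->]]]]; rewrite big1 ?eqxx// => i _.
  by apply: u0; rewrite finset.in_set0.
have [|B /asboolP avB eB] :=
    @eq_bigmax_cond _ (fun B : {set 'I_n} => `[< avoids L B >])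
      (fun B : {set 'I_n} => #|B|).
  by apply/card_gt0P; exists finset.set0.
by exists B.
Qed.

(** Let B be a largest set of indices avoided by L, and let N inside L miss L'.
    If no index could be added to B for L', then L' + U_B would meet every
    U_i, so it would be essential and meet N.  As L meets U_B trivially, such
    an element of N would already lie in L'. *)
Lemma codimension_lt L L' : left_ideal L -> left_ideal L' ->
  inessential_in L' L -> (codimension L < codimension L')%N.
Proof.
move=> hL hL' [L'L [N [hN nzN NL NL']]].
have [B avB ->] := avoids_codimension hL.
suff [i iB avi] : exists2 i, i \notin B & avoids L' (i |: B).
  have := @leq_bigmax_cond _ (fun B : {set 'I_n} => `[< avoids L' B >])
    (fun B : {set 'I_n} => #|B|) _ (asboolT avi).
  by rewrite cardsU1 iB.
apply: contrapT => nB.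
have [||_ /(_ N hN nzN)] := @essential_of_meets (lsum L' (partial_sum B)).
- by apply: lideal_lsum => //; exact: lideal_partial_sum.
- move=> i; have [iB|iB] := boolP (i \in B).
    have [_ [x Ux x0] _] := unifU i.
    exists x => //; split=> //; apply: lsum_subr => //.
    exists (fun j => if j == i then x else 0); split=> [j|j jB|].
    + by case: eqP => [->//|_]; exact: lideal0.
    + by case: eqP => [ji|//]; move: jB; rewrite ji iB.
    + by rewrite (bigD1 i)//= eqxx big1 ?addr0// => j /negPf->.
  (* an element of L' in U_B + U_i has a nonzero component in U_i, as L' misses
     U_B; this component is the common element of L' + U_B and U_i *)
  have [y [L'y [u [Uu u0 yE]]] y0] : nonzero_set (L' `&` partial_sum (i |: B)).
    by apply: contrapT => av; apply: nB; exists i.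
  have yB : partial_sum B (y - u i).
    exists (fun j => if j == i then 0 else u j); split=> [j|j jB|].
    + by case: eqP => // _; exact: lideal0.
    + by case: eqP => // /eqP ji; apply: u0; rewrite !inE negb_or ji.
    + rewrite yE (bigD1 i)//= addrAC subrr add0r [RHS](bigD1 i)//= eqxx add0r.
      by apply: eq_bigr => j /negPf->.
  exists (u i).
    split=> //; exists y, (- (y - u i)); split=> //; last first.
      by rewrite opprB addrC subrK.
    by apply: lidealN => //; exact: lideal_partial_sum.
  apply: contra_not_neq avB => ui0; exists y => //; split; first exact: L'L.
  by rewrite -[y]subr0 -ui0.
move=> [z [[y [v [L'y Bv zE]]] Nz] z0].
have v0 : v = 0.
  apply: (not_nonzeroP avB); split=> //.
  have -> : v = z - y by rewrite zE addrC addKr.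
  by apply: lidealB => //; [exact: NL | exact: L'L].
by apply: NL'; exists z => //; split=> //; rewrite zE v0 addr0.
Qed.

Lemma codimension_bound L : (codimension L <= n)%N.
Proof. by apply/bigmax_leqP => B _; rewrite -[n in (_ <= n)%N]card_ord max_card. Qed.

End Codimension.

Variable udimR : finite_left_udim R.

(** Descending chain condition up to essential inclusion: the codimension is
    maximal at x. *)
Lemma udim_minimal (T : Type) (P : T -> Prop) (L : T -> set R) :
  (forall x, left_ideal (L x)) -> (exists x, P x) ->
  exists2 x, P x & forall y, P y -> ~ inessential_in (L y) (L x).
Proof.
move=> hL exP; have [n [U [unifU dirU essU]]] := udimR.
have [x Px max] :=
  exists_max exP (fun x => codimension_bound U (L x)).
exists x => // y Py /(codimension_lt unifU dirU essU (hL x) (hL y)).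
by rewrite ltnNge max.
Qed.

(** Ascending chain condition up to essential inclusion: the codimension is
    minimal at x. *)
Lemma udim_maximal (T : Type) (P : T -> Prop) (L : T -> set R) :
  (forall x, left_ideal (L x)) -> (exists x, P x) ->
  exists2 x, P x & forall y, P y -> ~ inessential_in (L x) (L y).
Proof.
move=> hL exP; have [n [U [unifU dirU essU]]] := udimR.
have [x Px max] :=
  exists_max exP (fun x => leq_subr (codimension U (L x)) n).
exists x => // y Py /(codimension_lt unifU dirU essU (hL y) (hL x)) lt_yx.
have:= max y Py; rewrite leqNgt => /negP; apply.
by apply: ltn_sub2l => //; apply: leq_trans lt_yx _; exact: codimension_bound.
Qed.

(** If J misses Rc, then J c^k inside R c^k misses R c^(k+1), because right
    multiplication by c^k is injective; the chain of the R c^k would then be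
    strictly inessential at every step. *)
Lemma left_regular_essential c :
  left_regular R c -> essential_left_ideal (lprincipal c).
Proof.
move=> creg; split=> [|J hJ [j Jj j0]]; first exact: lideal_principal.
have [k _ kmin] := udim_minimal (fun k => lideal_principal (c ^+ k))
  (ex_intro (fun=> True) 0%N I).
have ckreg i x : x * c ^+ i = 0 -> x = 0.
  elim: i x => [|i IH] x; first by rewrite mulr1.
  by rewrite exprS mulrA => /IH/creg.
apply: contrapT => nz; apply: (kmin k.+1 I); split.
  by move=> _ [r ->]; exists (r * c); rewrite exprS mulrA.
exists [set y | exists2 r, J r & y = r * c ^+ k]; split.
- split=> [|_ _ [r Jr ->] [s Js ->]|s _ [r Jr ->]].
  + by exists 0; [exact: lideal0 | rewrite mul0r].
  + by exists (r - s); [exact: lidealB | rewrite mulrBl].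
  + by exists (s * r); [exact: lidealM | rewrite mulrA].
- exists (j * c ^+ k); first by exists j.
  by apply: contra_neq j0; exact: ckreg.
- by move=> _ [r _ ->]; exists r.
move=> [_ [[r Jr ->] [s sE]] rc0]; apply: nz; exists r.
  split=> //; exists s; apply: subr0_eq; apply: (ckreg k).
  by rewrite mulrBl sE exprS mulrA subrr.
by apply: contraNneq rc0 => ->; rewrite mul0r.
Qed.

(** A nonzero submodule of J that is extremal in codimension has only essential
    nonzero submodules. *)
Lemma uniform_sub J : left_ideal J -> nonzero_set J ->
  exists2 U, uniform_left_ideal U & U `<=` J.
Proof.
move=> hJ nzJ; pose T := {U : set R | left_ideal U}.
pose P (U : T) := nonzero_set (sval U) /\ sval U `<=` J.
have [||[U hU] [/= nzU UJ] Umin] := @udim_minimal T P sval.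
- by case.
- by exists (exist _ J hJ); split.
exists U => //; split=> // K L hK hL KU LU nzK nzL.
apply: contrapT => nz; apply: (Umin (exist _ L hL)).
  by split=> //= x /LU/UJ.
by split=> //; exists K.
Qed.

(** The condition that Rc meets the left annihilator of c trivially makes the
    sum Rc + U direct for every U inside this annihilator.  So x(c + u) = 0
    splits into xc = 0 and xu = 0, which shrinks the annihilator by U
    while preserving the condition.  The search starts at c = 0. *)
Lemma essential_meets_left_regular I :
  (forall U, uniform_left_ideal U -> left_regular_in U !=set0) ->
  essential_left_ideal I -> I `&` left_regular R !=set0.
Proof.
move=> regU [hI essI].
pose P c := I c /\ forall x, x * c * c = 0 -> x * c = 0.
have [||c [Ic cP] cmin] := @udim_minimal R P (@lann R).
- exact: lideal_ann.
- by exists 0; split=> [|x _]; [exact: lideal0 | rewrite mulr0].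
exists c; split=> // x xc0; apply: contrapT => /eqP x0.
have [||U unifU UI] := @uniform_sub (I `&` lann c).
- by apply: lideal_setI => //; exact: lideal_ann.
- by apply: essI; [exact: lideal_ann | exists x].
have [hU nzU _] := unifU; have [u [Uu injU]] := regU U unifU.
have [Iu uc0] := UI u Uu.
have uinj y : U y -> y * u = 0 -> y = 0.
  move=> Uy yu0; apply: injU; rewrite ?inE ?mul0r//; exact: lideal0.
have annE y : y * (c + u) = 0 -> y * c = 0 /\ y * u = 0.
  rewrite mulrDr => ycu.
  have yc0 : y * c = 0.
    apply: cP; have -> : y * c = - (y * u) by apply/eqP; rewrite -addr_eq0 ycu.
    by rewrite mulNr -mulrA uc0 mulr0 oppr0.
  by split=> //; move: ycu; rewrite yc0 add0r.
apply: (cmin (c + u)).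
  split; first exact: lidealD.
  move=> y /annE[]; rewrite !mulrDr !mulrDl -[y * u * c]mulrA uc0 mulr0 addr0.
  move=> /cP yc0; rewrite yc0 mul0r !add0r => /uinj; apply.
  exact: lidealM.
split=> [y /annE[]//|]; exists U; split=> //.
- by move=> y /UI[].
- by move=> [y [Uy /annE[_ /(uinj y Uy) ->]]]; rewrite eqxx.
Qed.

End FiniteUniformDimension.

(** * Families of left ideals with zero members *)

(** The zero members of a family contribute nothing to its sum, so keeping only
    the uniform ones leaves a witness of finite uniform dimension. *)
Lemma udim_of_uniform_or_zero (R : pzRingType) n (U : 'I_n -> set R) :
  (forall i, uniform_left_ideal (U i) \/ U i = [set 0]) ->
  direct_left_ideals U -> essential_left_ideal (sum_left_ideals U) ->
  finite_left_udim R.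
Proof.
move=> hU dirU essU.
pose A : pred 'I_n := fun i => `[< uniform_left_ideal (U i) >].
pose V (k : 'I_#|A|) := U (enum_val k).
have unifV k : uniform_left_ideal (V k).
  by have /asboolP := enum_valP k.
have U0 i : U i 0.
  by case: (hU i) => [[hUi _ _]|->//]; exact: lideal0.
exists #|A|, V; split=> // [u Vu u0 k|].
  (* v extends u by zero outside the uniform indices *)
  pose v i := \sum_(j | enum_val j == i) u j.
  have vE j : v (enum_val j) = u j.
    rewrite /v (bigD1 j)//= big1 ?addr0// => l /andP[/eqP/enum_val_inj->].
    by rewrite eqxx.
  rewrite -vE; apply: dirU => [i|].
    have [Ai|nAi] := pselect (uniform_left_ideal (U i)).
      have iA : i \in A by apply/asboolP.
      by rewrite -(enum_rankK_in iA iA) vE; exact: Vu.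
    rewrite /v big1// => j /eqP ji; exfalso; apply: nAi.
    by rewrite -ji; exact: unifV.
  rewrite -[RHS]u0 /v; symmetry.
  by rewrite (partition_big (fun j => enum_val j) predT).
suff <- : sum_left_ideals U = sum_left_ideals V by [].
apply/seteqP; split=> x [u Uu ->].
  exists (fun k => u (enum_val k)) => [k|]; first exact: Uu.
  rewrite (bigID A)/= [X in _ + X]big1 ?addr0 => [|i nAi].
    exact: big_enum_val.
  have [Ai|Ui0] := hU i; last by have := Uu i; rewrite Ui0.
  by case/negP: nAi; apply/asboolP.
pose v i := \sum_(j | enum_val j == i) u j.
exists v => [i|]; last by rewrite (partition_big (fun j => enum_val j) predT).
have [Ai|nAi] := pselect (uniform_left_ideal (U i)).
  have [hUi _ _] := Ai.
  by apply: lideal_sum => // j /eqP <-; exact: Uu.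
rewrite /v big1// => j /eqP ji; exfalso; apply: nAi.
by rewrite -ji; exact: unifV.
Qed.

(** * Rings without proper essential left ideals *)

Lemma decreasing_chain (T : Type) (I : nat -> set T) m k :
  (forall k, I k.+1 `<=` I k) -> (m <= k)%N -> I k `<=` I m.
Proof.
move=> decI; elim: k => [|k IH]; first by rewrite leqn0 => /eqP->.
rewrite leq_eqVlt => /orP[/eqP->//|/IH]; exact: subset_trans.
Qed.

Section NoProperEssential.
Variable Q : pzRingType.
Hypothesis udimQ : finite_left_udim Q.
Hypothesis essQ : forall I : set Q, essential_left_ideal I -> I 1.
Implicit Types I J K L : set Q.

Lemma essential_setT I : essential_left_ideal I -> I = setT.
Proof.
move=> essI; apply/seteqP; split=> // x _; rewrite -[x]mulr1.
by apply: lidealM; [case: essI | exact: essQ].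
Qed.

(** For x in L the left ideal of all r with rx in L' is essential when L' is
    essential in L, so it contains 1. *)
Lemma not_inessential_eq L L' : left_ideal L' -> L' `<=` L ->
  left_ideal L -> ~ inessential_in L' L -> L' = L.
Proof.
move=> hL' L'L hL ess; apply/seteqP; split=> // x Lx.
have /essQ : essential_left_ideal [set r | L' (r * x)].
  apply: colon_essential => // J hJ nzJ Jx; apply: contrapT => nz; apply: ess.
  split=> //; exists J; split=> //.
  by apply: (subset_trans Jx); exact: lprincipal_sub.
by rewrite /= mul1r.
Qed.

Lemma no_essential_left_semisimple : left_semisimple Q.
Proof.
have [n [U [unifU dirU essU]]] := udimQ.
exists n, U; split=> // [i|]; last exact: essential_setT.
have [hU nzU uni] := unifU i; split=> // J hJ nzJ JU.
apply: not_inessential_eq => // -[_ [N [hN nzN NU]]]; apply; exact: uni.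
Qed.

Lemma no_essential_left_artinian : left_artinian Q.
Proof.
move=> I hI decI.
have leI m k := @decreasing_chain _ I m k decI.
have [n _ nmin] := udim_minimal udimQ hI (ex_intro (fun=> True) 0%N Logic.I).
by exists n => m nm; apply: not_inessential_eq; [|exact: leI| |exact: nmin].
Qed.

(** A left ideal N that is maximal among those missing Qx satisfies
    N + Qx = Q.  Write 1 = u + yx with u in N; then xu = x - xyx lies in both N
    and Qx, so it vanishes. *)
Lemma no_essential_von_neumann (x : Q) : exists y, x = x * y * x.
Proof.
pose T := {N : set Q | left_ideal N}.
pose P (N : T) := ~ nonzero_set (sval N `&` lprincipal x).
have z0 : left_ideal [set (0 : Q)].
  split=> [//|y z /= -> ->|r y /= ->]; first exact: subr0.
  by rewrite mulr0.
have hx := lideal_principal x.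
have [||[N hN] /= NP Nmax] := udim_maximal udimQ (P := P) (L := sval).
- by case.
- by exists (exist _ _ z0) => -[y [/= ->]]; rewrite eqxx.
have /essQ : essential_left_ideal (lsum N (lprincipal x)).
  split=> [|K hK nzK]; first exact: lideal_lsum.
  apply: contrapT => nz.
  apply: (Nmax (exist _ _ (lideal_lsum hN hK))) => /=.
    move=> [_ [[u [k [Nu Kk ->]]] /= ux] uk0].
    have k0 : k = 0.
      apply: (not_nonzeroP nz); split=> //; exists (- u), (u + k).
      by split=> //; [exact: lidealN | rewrite addKr].
    apply: NP; exists u; first by split=> //; move: ux; rewrite k0 addr0.
    by move: uk0; rewrite k0 addr0.
  split; first exact: lsum_subl.
  exists K; split=> //; first exact: lsum_subr.
  move=> [k [Kk Nk] k0]; apply: nz; exists k => //.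
  by split=> //; exact: lsum_subl.
move=> [u [_ [Nu [y ->] E]]]; exists y; apply: subr0_eq.
have xu : x * u = x - x * y * x.
  by rewrite -mulrA -[u](addrK (y * x)) -E mulrBr mulr1.
apply: (not_nonzeroP NP); split; first by rewrite /= -xu; exact: lidealM.
by exists (1 - x * y); rewrite mulrBl mul1r.
Qed.

(** Take an idempotent e in J whose left annihilator is minimal.  If ej differs
    from j, then z = j - ej = zyz gives an idempotent f = zy of J with ef = 0,
    and h = f - fe is orthogonal to e, so that the idempotent e + h of J has a
    smaller annihilator: it omits 1 - e. *)
Lemma no_essential_right_ideal_idempotent (J : set Q) :
  left_ideal (J : set Q^c) -> exists2 e, J e & forall j, J j -> e * j = j.
Proof.
move=> hJ.
have JM x r : J x -> J (x * r) by exact: (lidealM (R := Q^c)).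
pose P (e : Q) := J e /\ e * e = e.
have [||e [Je ee] emin] := udim_minimal udimQ (P := P) (L := @lann Q).
- exact: lideal_ann.
- by exists 0; split; [exact: lideal0 hJ | rewrite mulr0].
exists e => // j Jj; apply/eqP; rewrite -subr_eq0 -opprB oppr_eq0; apply/eqP.
set z := j - e * j.
have Jz : J z by apply: (lidealB hJ) => //; exact: JM.
have ez : e * z = 0 by rewrite /z mulrBr mulrA ee subrr.
have [y zyz] := no_essential_von_neumann z.
have [f [Jf ff ef fz]] : exists f, [/\ J f, f * f = f, e * f = 0 & f * z = z].
  exists (z * y); rewrite -zyz; split=> //; first exact: JM.
    by rewrite mulrA -zyz.
  by rewrite mulrA ez mul0r.
have [h hE] : exists h, h = f - f * e by exists (f - f * e).
have he : h * e = 0 by rewrite hE mulrBl -mulrA ee subrr.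
have eh : e * h = 0 by rewrite hE mulrBr mulrA ef mul0r subrr.
have fh : f * h = h by rewrite hE mulrBr mulrA ff.
have hf : h * f = f by rewrite hE mulrBl ff -mulrA ef mulr0 subr0.
have hh : h * h = h by rewrite -{2}fh mulrA hf.
have Pg : P (e + h).
  split.
    apply: (lidealD hJ) => //; rewrite hE.
    by apply: (lidealB hJ) => //; exact: JM.
  by rewrite mulrDl !mulrDr ee eh he hh addr0 add0r.
have annE : lann (e + h) = lann e.
  apply: not_inessential_eq (emin _ Pg); try exact: lideal_ann.
  move=> q qg; rewrite /lann /=.
  have: q * (e + h) * e = 0 by rewrite qg mul0r.
  by rewrite -mulrA mulrDl ee he addr0.
have : lann (e + h) (1 - e) by rewrite annE /lann /= mulrBl mul1r ee subrr.
rewrite /lann /= mulrBl mul1r mulrDr ee eh addr0 addrC addKr hE => h0.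
have fE : f = f * e by apply: subr0_eq.
by rewrite -/z -fz -ff {1}fE -(mulrA f) ef mulr0 mul0r.
Qed.

(** Left annihilators turn a descending chain of right ideals into an
    ascending chain of left ideals, which is stationary.  Since a right ideal
    eQ consists of all x with (1 - e)x = 0, it is recovered from its left
    annihilator. *)
Lemma no_essential_right_artinian : left_artinian Q^c.
Proof.
move=> I hI decI.
have leI m k := @decreasing_chain _ I m k decI.
pose L k := [set q : Q | forall x : Q, I k x -> q * x = 0].
have hL k : left_ideal (L k).
  split=> [x _|q q' Lq Lq' x Ix|r q Lq x Ix]; first exact: mul0r.
    by rewrite mulrBl Lq// Lq'// subrr.
  by rewrite -mulrA Lq// mulr0.
have [n _ nmax] := udim_maximal udimQ hL (ex_intro (fun=> True) 0%N Logic.I).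
exists n => m nm; apply/seteqP; split; first exact: leI.
have LnLm : L n = L m.
  apply: not_inessential_eq => //; last exact: nmax.
  by move=> q Lq x /(leI _ _ nm)/Lq.
have [e Ie eI] := no_essential_right_ideal_idempotent (hI m).
move=> x Inx; have : L m (1 - e).
  by move=> y Imy; rewrite mulrBl mul1r (eI y Imy) subrr.
rewrite -LnLm => /(_ x Inx)/eqP; rewrite mulrBl mul1r subr_eq0 => /eqP xE.
by rewrite xE; exact: (lidealM (R := Q^c) x (hI m) Ie).
Qed.

Lemma no_essential_semisimple_artinian : semisimple_artinian Q.
Proof.
split; [exact: no_essential_left_semisimple|exact: no_essential_left_artinian|].
exact: no_essential_right_artinian.
Qed.

(** Qx is essential, hence contains 1 = zx; left regularity turns the left
    inverse z into a two-sided one. *)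
Lemma no_essential_left_regular_unit x : left_regular Q x -> ring_units Q x.
Proof.
move=> xreg; have [z zx] := essQ (left_regular_essential udimQ xreg).
exists z; split=> //; apply: subr0_eq; apply: xreg.
by rewrite mulrBl mul1r -mulrA -zx mulr1 subrr.
Qed.

End NoProperEssential.

(** * Construction of the left Ore localization *)

Section OreLocalization.
Variables (R : pzRingType) (S : set R).
Implicit Types r t x y : R.

(** The left Ore condition, as it is used: the fraction r s^-1 can be rewritten
    as t^-1 x. *)
Lemma ore_witness r s : left_ore S -> S s ->
  exists t x, S t /\ t * r = x * s.
Proof.
by move=> [_ /(_ r s)] /[apply] -[_ [[t St <-] [x _ xs]]]; exists t, x.
Qed.

Lemma ore_common s t : left_ore S -> S s -> S t ->
  exists u v, [/\ S u, S (u * s) & u * s = v * t].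
Proof.
move=> oreS Ss St; have [u [v [Su uv]]] := ore_witness s oreS St.
by exists u, v; split=> //; case: oreS => -[_ SM _] _; exact: SM.
Qed.

Lemma ideal_ass : left_ore S -> ideal (ass S).
Proof.
move=> oreS; have [[S1 SM _] _] := oreS; split; first split.
- by exists 1 => //; rewrite mulr0.
- move=> x y [s Ss sx0] [t St ty0].
  have [u [v [Su Sus uv]]] := ore_common oreS Ss St.
  exists (u * s) => //; rewrite mulrBr {2}uv -!mulrA sx0 ty0 !mulr0.
  exact: subr0.
- move=> r x [s Ss sx0]; have [t [y [St ty]]] := ore_witness r oreS Ss.
  by exists t => //; rewrite mulrA ty -mulrA sx0 mulr0.
by move=> r x [s Ss sx0]; exists s => //; rewrite mulrA sx0 mul0r.
Qed.

Hypothesis denS : left_denominator S.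

Let oreS : left_ore S. Proof. by case: denS. Qed.
Let S1 : S 1. Proof. by case: oreS => -[]. Qed.
Let SM s t : S s -> S t -> S (s * t).
Proof. by case: oreS => -[_ SM _] _; exact: SM. Qed.
Let ass_cancel u x : S u -> ass S (u * x) -> ass S x.
Proof.
by move=> Su [s Ss sux]; exists (s * u); [exact: SM | rewrite -mulrA].
Qed.

(** A fraction q is represented by its graph, the submodule of R x R formed by
    the pairs (t, x) with t q = x in the localization.  This avoids choosing
    numerators and denominators, and equality of fractions is equality of
    sets. *)
Record fraction_graph (P : R -> R -> Prop) : Prop := FractionGraph {
  graphB : forall t x t' x', P t x -> P t' x' -> P (t - t') (x - x');
  graphM : forall r t x, P t x -> P (r * t) (r * x);
  graph0 : forall x, P 0 x -> ass S x;
  graph_denom : exists s x, S s /\ P s x }.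

Record fraction := Fraction {
  fgraph :> R -> R -> Prop;
  fgraphP : fraction_graph fgraph;
  fgraph_sat : forall u t x, S u -> fgraph (u * t) (u * x) -> fgraph t x }.

(** Adding or composing the graphs of two fractions yields only some of the
    pairs of the sum or product, those with a suitable denominator; closing
    under left cancellation of S recovers all of them. *)
Definition saturation (P : R -> R -> Prop) t x : Prop :=
  exists2 u, S u & P (u * t) (u * x).

Lemma saturation_graph P : fraction_graph P -> fraction_graph (saturation P).
Proof.
move=> hP; split.
- move=> t x t' x' [u Su Pu] [u' Su' Pu'].
  have [v [v' [Sv Svu vv']]] := ore_common oreS Su Su'.
  exists (v * u) => //; rewrite !mulrBr; apply: (graphB hP).
    by rewrite -!mulrA; exact: graphM.
  by rewrite vv' -!mulrA; exact: graphM.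
- move=> r t x [u Su Pu]; have [w [v [Sw wv]]] := ore_witness r oreS Su.
  by exists w => //; rewrite !mulrA wv -!mulrA; exact: graphM.
- by move=> x [u Su]; rewrite mulr0 => /(graph0 hP)/(ass_cancel Su).
- have [s [x [Ss Psx]]] := graph_denom hP.
  by exists s, x; split=> //; exists 1; rewrite ?mul1r.
Qed.

Lemma saturation_sat P u t x :
  S u -> saturation P (u * t) (u * x) -> saturation P t x.
Proof.
by move=> Su [v Sv]; rewrite !mulrA => Pv; exists (v * u) => //; exact: SM.
Qed.

Definition fraction_of P (hP : fraction_graph P) : fraction :=
  Fraction (saturation_graph hP) (@saturation_sat P).

Lemma fraction_ofI P (hP : fraction_graph P) t x : P t x -> fraction_of hP t x.
Proof. by exists 1; rewrite ?mul1r. Qed.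

Section FractionTheory.
Implicit Types p q : fraction.

Lemma fractionB q t x t' x' : q t x -> q t' x' -> q (t - t') (x - x').
Proof. exact: graphB (fgraphP q) _ _ _ _. Qed.

Lemma fractionM q r t x : q t x -> q (r * t) (r * x).
Proof. exact: graphM (fgraphP q) _ _ _. Qed.

Lemma fraction_ass q x : q 0 x <-> ass S x.
Proof.
split=> [|[s Ss sx0]]; first exact: graph0 (fgraphP q) _.
have [t [y [_ qty]]] := graph_denom (fgraphP q).
apply: (fgraph_sat Ss); rewrite sx0 mulr0.
by have := fractionM 0 qty; rewrite !mul0r.
Qed.

Lemma fraction0 q : q 0 0.
Proof. by apply/fraction_ass; exists 1; rewrite ?mulr0. Qed.

Lemma fractionN q t x : q t x -> q (- t) (- x).
Proof. by rewrite -[- t]add0r -[- x]add0r; apply: fractionB; exact: fraction0. Qed.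

Lemma fractionD q t x t' x' : q t x -> q t' x' -> q (t + t') (x + x').
Proof.
by move=> qt /fractionN qt'; rewrite -[t']opprK -[x']opprK; exact: fractionB.
Qed.

Lemma fraction_dense q t : exists u x, S u /\ q (u * t) x.
Proof.
have [s [x [Ss qsx]]] := graph_denom (fgraphP q).
have [u [v [Su uv]]] := ore_witness t oreS Ss.
by exists u, (v * x); split=> //; rewrite uv; exact: fractionM.
Qed.

Lemma fraction_fun q t x y : q t x -> q t y -> ass S (x - y).
Proof. by move=> qx /(fractionB qx); rewrite subrr => /fraction_ass. Qed.

Lemma fraction_sub p q u x : S u -> p u x -> q u x -> forall t y, p t y -> q t y.
Proof.
move=> Su pu qu t y pt; have [w [v [Sw wv]]] := ore_witness t oreS Su.
have /fraction_fun : p (w * t) (w * y) by exact: fractionM.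
move=> /(_ (v * x)); rewrite {1}wv => /(_ (fractionM _ pu))/(fraction_ass q) qd.
apply: (fgraph_sat Sw); rewrite -[w * y](subrK (v * x)) -[w * t]add0r.
by apply: fractionD => //; rewrite wv; exact: fractionM.
Qed.

(** One common pair (u, x) with denominator u in S determines a fraction, namely
    u^-1 x.  Every ring axiom below follows by exhibiting such a pair. *)
Lemma fraction_eq p q u x : S u -> p u x -> q u x -> p = q.
Proof.
move=> Su pu qu.
have : fgraph p = fgraph q.
  apply/funext => t; apply/funext => y; apply/propext.
  by split; [exact: fraction_sub pu qu t y | exact: fraction_sub qu pu t y].
case: p q {pu qu} => [P hP sP] [Q hQ sQ] /= PQ; rewrite -PQ in hQ sQ *.
by congr Fraction; exact: Prop_irrelevance.
Qed.

Lemma scalar_graph r : fraction_graph (fun t x => x = t * r).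
Proof.
split=> [t x t' x' -> ->|s t x ->|x ->|].
- by rewrite mulrBl.
- by rewrite mulrA.
- by exists 1; rewrite // mul0r mulr0.
- by exists 1, (1 * r).
Qed.

Lemma add_graph p q :
  fraction_graph (fun t z => exists x y, [/\ p t x, q t y & z = x + y]).
Proof.
split.
- move=> t _ t' _ [x [y [px qy ->]]] [x' [y' [px' qy' ->]]].
  exists (x - x'), (y - y'); split; [exact: fractionB | exact: fractionB |].
  by rewrite opprD addrACA.
- move=> r t _ [x [y [px qy ->]]]; exists (r * x), (r * y).
  by split; [exact: fractionM | exact: fractionM | rewrite mulrDr].
- move=> _ [x [y [/fraction_ass ax /fraction_ass ay ->]]].
  by case: (ideal_ass oreS) => hI _; exact: lidealD.
- have [s [x [Ss psx]]] := graph_denom (fgraphP p).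
  have [u [y [Su quy]]] := fraction_dense q s.
  exists (u * s), (u * x + y); split; first exact: SM.
  by exists (u * x), y; split=> //; exact: fractionM.
Qed.

Lemma opp_graph q : fraction_graph (fun t x => q t (- x)).
Proof.
split=> [t x t' x' qx qx'|r t x|x /fraction_ass|].
- by rewrite opprD; exact: fractionB.
- by rewrite -mulrN; exact: fractionM.
- by case: (ideal_ass oreS) => hI _ /(lidealN hI); rewrite opprK.
- have [s [x [Ss qsx]]] := graph_denom (fgraphP q).
  by exists s, (- x); rewrite opprK.
Qed.

(** Composition of graphs: t p = x and x q = y give t (p q) = y. *)
Lemma mul_graph p q : fraction_graph (fun t y => exists2 x, p t x & q x y).
Proof.
split.
- move=> t y t' y' [x px qx] [x' px' qx'].
  by exists (x - x'); exact: fractionB.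
- by move=> r t y [x px qx]; exists (r * x); exact: fractionM.
- move=> y [x /fraction_ass[s Ss sx0] qxy].
  apply: (ass_cancel Ss); apply/(fraction_ass q).
  by rewrite -sx0; exact: fractionM.
- have [s [x [Ss psx]]] := graph_denom (fgraphP p).
  have [u [y [Su quy]]] := fraction_dense q x.
  exists (u * s), y; split; first exact: SM.
  by exists (u * x) => //; exact: fractionM.
Qed.

(** The graph of s^-1.  Its single-valuedness modulo ass S is where the
    reversibility condition on S enters. *)
Lemma inv_graph s : S s -> fraction_graph (fun t x => t = x * s).
Proof.
move=> Ss; split=> [t x t' x' -> ->|r t x ->|x|].
- by rewrite mulrBl.
- by rewrite mulrA.
- by move/esym => xs0; have [_] := denS; apply; [exact: Ss|].
- by exists (1 * s), 1; rewrite {1}mul1r.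
Qed.

End FractionTheory.

(** The proof that S is a left denominator set is an argument so that the ring
    structure, which depends on it, can be attached to this type. *)
Definition ore_localization of left_denominator S := fraction.

Local Notation Q := (ore_localization denS).
HB.instance Definition _ := gen_eqMixin Q.
HB.instance Definition _ := gen_choiceMixin Q.

Definition fraction_scalar r : Q := fraction_of (scalar_graph r).
Definition fraction_add (p q : Q) : Q := fraction_of (add_graph p q).
Definition fraction_opp (q : Q) : Q := fraction_of (opp_graph q).
Definition fraction_mul (p q : Q) : Q := fraction_of (mul_graph p q).

Lemma fraction_scalarI r t x : x = t * r -> fraction_scalar r t x.
Proof. exact: fraction_ofI. Qed.

Lemma fraction_addI (p q : Q) t x y :
  fgraph p t x -> fgraph q t y -> fgraph (fraction_add p q) t (x + y).
Proof. by move=> px qy; apply: fraction_ofI; exists x, y. Qed.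

Lemma fraction_oppI (q : Q) t x : fgraph q t x -> fgraph (fraction_opp q) t (- x).
Proof. by move=> qx; apply: fraction_ofI; rewrite opprK. Qed.

Lemma fraction_mulI (p q : Q) t x y :
  fgraph p t x -> fgraph q x y -> fgraph (fraction_mul p q) t y.
Proof. by move=> px qy; apply: fraction_ofI; exists x. Qed.

Lemma fraction_common2 (p q : Q) :
  exists s x y, [/\ S s, fgraph p s x & fgraph q s y].
Proof.
have [s [x [Ss psx]]] := graph_denom (fgraphP p).
have [u [y [Su quy]]] := fraction_dense q s.
exists (u * s), (u * x), y; split=> //; [exact: SM | exact: fractionM].
Qed.

Lemma fraction_common3 (p q r : Q) :
  exists s x y z, [/\ S s, fgraph p s x, fgraph q s y & fgraph r s z].
Proof.
have [s [x [y [Ss px qy]]]] := fraction_common2 p q.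
have [u [z [Su rz]]] := fraction_dense r s.
exists (u * s), (u * x), (u * y), z.
by split=> //; [exact: SM | exact: fractionM | exact: fractionM].
Qed.

Lemma fraction_addA : associative fraction_add.
Proof.
move=> p q r; have [s [x [y [z [Ss px qy rz]]]]] := fraction_common3 p q r.
apply: (fraction_eq (x := x + (y + z)) Ss).
  by apply: fraction_addI => //; exact: fraction_addI.
by rewrite addrA; apply: fraction_addI => //; exact: fraction_addI.
Qed.

Lemma fraction_addC : commutative fraction_add.
Proof.
move=> p q; have [s [x [y [Ss px qy]]]] := fraction_common2 p q.
apply: (fraction_eq (x := x + y) Ss); first exact: fraction_addI.
by rewrite addrC; exact: fraction_addI.
Qed.

Lemma fraction_add0 : left_id (fraction_scalar 0) fraction_add.
Proof.
move=> q; have [s [x [Ss qx]]] := graph_denom (fgraphP q).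
apply: (fraction_eq (x := x) Ss) => //.
rewrite -[x]add0r; apply: fraction_addI => //.
by apply: fraction_scalarI; rewrite mulr0.
Qed.

Lemma fraction_addN : left_inverse (fraction_scalar 0) fraction_opp fraction_add.
Proof.
move=> q; have [s [x [Ss qx]]] := graph_denom (fgraphP q).
apply: (fraction_eq (x := 0) Ss).
  by rewrite -(addNr x); apply: fraction_addI => //; exact: fraction_oppI.
by apply: fraction_scalarI; rewrite mulr0.
Qed.

Lemma fraction_mulA : associative fraction_mul.
Proof.
move=> p q r; have [s [x [Ss px]]] := graph_denom (fgraphP p).
have [u [y [Su qy]]] := fraction_dense q x.
have [v [z [Sv rz]]] := fraction_dense r y.
have pvx : p (v * (u * s)) (v * (u * x)) by do 2!apply: fractionM.
have qvy : q (v * (u * x)) (v * y) by exact: fractionM.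
apply: (fraction_eq (x := z) (u := v * (u * s))); first exact: SM Sv (SM Su Ss).
  by apply: (fraction_mulI pvx); exact: fraction_mulI rz.
by apply: fraction_mulI rz; exact: fraction_mulI qvy.
Qed.

Lemma fraction_mul1l : left_id (fraction_scalar 1) fraction_mul.
Proof.
move=> q; have [s [x [Ss qx]]] := graph_denom (fgraphP q).
apply: (fraction_eq (x := x) Ss) => //.
by apply: fraction_mulI qx; apply: fraction_scalarI; rewrite mulr1.
Qed.

Lemma fraction_mul1r : right_id (fraction_scalar 1) fraction_mul.
Proof.
move=> q; have [s [x [Ss qx]]] := graph_denom (fgraphP q).
apply: (fraction_eq (x := x) Ss) => //.
by apply: (fraction_mulI qx); apply: fraction_scalarI; rewrite mulr1.
Qed.

Lemma fraction_mulDl : left_distributive fraction_mul fraction_add.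
Proof.
move=> p q r; have [s [x [y [Ss px qy]]]] := fraction_common2 p q.
have [u [z [Su rz]]] := fraction_dense r x.
have [v [w [Sv rw]]] := fraction_dense r (u * y).
have {}px := fractionM v (fractionM u px).
have {}qy := fractionM v (fractionM u qy).
have {}rz := fractionM v rz.
apply: (fraction_eq (x := v * z + w) (u := v * (u * s))).
- exact: SM Sv (SM Su Ss).
- by apply: fraction_mulI (fraction_addI px qy) _; exact: fractionD.
- by apply: fraction_addI; [exact: fraction_mulI rz | exact: fraction_mulI rw].
Qed.

Lemma fraction_mulDr : right_distributive fraction_mul fraction_add.
Proof.
move=> p q r; have [s [x [Ss px]]] := graph_denom (fgraphP p).
have [u [y [Su qy]]] := fraction_dense q x.
have [v [z [Sv rz]]] := fraction_dense r (u * x).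
have {}px := fractionM v (fractionM u px).
have {}qy := fractionM v qy.
apply: (fraction_eq (x := v * y + z) (u := v * (u * s))).
- exact: SM Sv (SM Su Ss).
- by apply: (fraction_mulI px); exact: fraction_addI.
- by apply: fraction_addI; [exact: fraction_mulI qy | exact: fraction_mulI rz].
Qed.

HB.instance Definition _ := GRing.isZmodule.Build Q
  fraction_addA fraction_addC fraction_add0 fraction_addN.
HB.instance Definition _ := GRing.Zmodule_isPzRing.Build Q
  fraction_mulA fraction_mul1l fraction_mul1r fraction_mulDl fraction_mulDr.

Lemma fraction_scalarB : {morph fraction_scalar : x y / x - y}.
Proof.
move=> x y; apply: (fraction_eq (x := 1 * x - 1 * y) S1).
  by apply: fraction_scalarI; rewrite mulrBr.
apply: fraction_addI; first exact: fraction_scalarI.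
by apply: fraction_oppI; exact: fraction_scalarI.
Qed.

Lemma fraction_scalar_monoid : monoid_morphism fraction_scalar.
Proof.
split=> // x y; apply: (fraction_eq (x := 1 * x * y) S1).
  by apply: fraction_scalarI; rewrite mulrA.
by apply: (@fraction_mulI _ _ _ (1 * x)); exact: fraction_scalarI.
Qed.

HB.instance Definition _ :=
  GRing.isZmodMorphism.Build R Q fraction_scalar fraction_scalarB.
HB.instance Definition _ :=
  GRing.isMonoidMorphism.Build R Q fraction_scalar fraction_scalar_monoid.

Lemma ore_localizationP :
  is_left_localization S (fraction_scalar : {rmorphism R -> Q}).
Proof.
split=> [s Ss|q|r].
- have inv1 : fgraph (fraction_of (inv_graph Ss)) s 1.
    by apply: fraction_ofI; rewrite mul1r.
  exists (fraction_of (inv_graph Ss) : Q); split.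
    apply: (fraction_eq (x := s) Ss).
      by apply: (fraction_mulI inv1); apply: fraction_scalarI; rewrite mul1r.
    by apply: fraction_scalarI; rewrite mulr1.
  apply: (fraction_eq (x := 1) S1).
    by apply: fraction_mulI inv1; apply: fraction_scalarI; rewrite mul1r.
  by apply: fraction_scalarI; rewrite mulr1.
- have [s [r [Ss qsr]]] := graph_denom (fgraphP q).
  exists s, r; split=> //; apply: (fraction_eq (x := r) S1).
    by apply: fraction_mulI qsr; apply: fraction_scalarI; rewrite mul1r.
  by apply: fraction_scalarI; rewrite mul1r.
- split=> [r0|[u Su ur0]].
    apply/(fraction_ass (fraction_scalar r)); rewrite -(subrr 1).
    have r1 : fgraph (fraction_scalar r) 1 0.
      by rewrite r0; apply: fraction_scalarI; rewrite mulr0.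
    have := fractionB (fraction_scalarI (erefl (1 * r))) r1.
    by rewrite mul1r subr0.
  apply: (fraction_eq (x := 0) Su).
    exact: fraction_scalarI.
  by apply: fraction_scalarI; rewrite mulr0.
Qed.

End OreLocalization.

(** * Universal property of localizations *)

Lemma exists_rmorphism (A B : pzRingType) (f : A -> B) :
  {morph f : x y / x - y} -> monoid_morphism f ->
  exists phi : {rmorphism A -> B}, forall x, phi x = f x.
Proof.
move=> fB fM.
pose phi : {rmorphism A -> B} := HB.pack_for {rmorphism A -> B} f
  (GRing.isZmodMorphism.Build A B f fB) (GRing.isMonoidMorphism.Build A B f fM).
by exists phi.
Qed.

Lemma ring_unit_cancel (A : pzRingType) (u x y : A) :
  ring_units A u -> u * x = u * y -> x = y.
Proof.
by move=> [v [vu _]] uxy; rewrite -[x]mul1r -vu -mulrA uxy mulrA vu mul1r.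
Qed.

Lemma ring_unit_cancelr (A : pzRingType) (u x y : A) :
  ring_units A u -> x * u = y * u -> x = y.
Proof.
by move=> [v [_ uv]] uxy; rewrite -[x]mulr1 -uv mulrA uxy -mulrA uv mulr1.
Qed.

Lemma quotient_rmorphism (R Q : pzRingType) (J : set R) (hJ : ideal J)
    (f : {rmorphism R -> Q}) : (forall x, J x -> f x = 0) ->
  exists g : {rmorphism quotient_ring hJ -> Q},
    forall r, g (quotient_proj hJ r) = f r.
Proof.
move=> fJ.
pose g (x : quotient_ring hJ) : Q :=
  f (repr (x : Quotient.quot (ideal_pred hJ))).
have gE r : g (quotient_proj hJ r) = f r.
  apply: subr0_eq; rewrite -rmorphB; apply: fJ.
  by apply/quotient_projP; rewrite quotient_projK.
have [x y||phi phiE] := @exists_rmorphism _ _ g.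
- have [a ->] := quotient_proj_surj x; have [b ->] := quotient_proj_surj y.
  by rewrite -quotient_projB !gE rmorphB.
- split=> [|x y]; first by rewrite -(rmorph1 f) -gE.
  have [a ->] := quotient_proj_surj x; have [b ->] := quotient_proj_surj y.
  by rewrite -(rmorphM (quotient_proj hJ)) !gE rmorphM.
by exists phi => r; rewrite phiE.
Qed.

Section LocalizationTheory.
Variables (R Q : pzRingType) (S : set R) (sigma : {rmorphism R -> Q}).
Hypothesis oreS : left_ore S.
Hypothesis locS : is_left_localization S sigma.

Lemma localization_ore t x s r q : S s ->
  sigma t * q = sigma x -> sigma s * q = sigma r ->
  exists u v, [/\ S u, u * t = v * s & ass S (u * x - v * r)].
Proof.
move=> Ss tq sq; have [u [v [Su uv]]] := ore_witness t oreS Ss.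
exists u, v; split=> //; have [_ _ ker] := locS; apply/ker.
by rewrite rmorphB !rmorphM/= -tq -sq !mulrA -!rmorphM uv subrr.
Qed.

Lemma localization_common2 p q :
  exists s x y, [/\ S s, sigma s * p = sigma x & sigma s * q = sigma y].
Proof.
have [_ dense _] := locS.
have [s [x [Ss sp]]] := dense p; have [t [y [St tq]]] := dense q.
have [u [v [Su Sus uv]]] := ore_common oreS Ss St.
exists (u * s), (u * x), (v * y); split=> //.
  by rewrite !rmorphM -mulrA sp.
by rewrite uv !rmorphM -mulrA tq.
Qed.

(** The image of q is the unique q' such that t q = x in Q implies t q' = x in
    Q', for all t and x in R.  The Ore condition makes this consistent for
    the different fractions representing q. *)
Lemma localization_universal (Q' : pzRingType) (f : {rmorphism R -> Q'}) :
  (forall s, S s -> ring_units Q' (f s)) ->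
  exists phi : {rmorphism Q -> Q'}, forall r, phi (sigma r) = f r.
Proof.
move=> funit; have [sunit dense ker] := locS.
have [[S1 SM _] _] := oreS.
have fass x : ass S x -> f x = 0.
  move=> [s Ss sx0]; apply: (ring_unit_cancel (funit s Ss)).
  by rewrite -rmorphM sx0 rmorph0 mulr0.
pose P q q' := forall t x, sigma t * q = sigma x -> f t * q' = f x.
have /choice[g gP] q : exists q', P q q'.
  have [s [r [Ss sq]]] := dense q; have [v [_ uv]] := funit s Ss.
  exists (v * f r) => t x tq.
  have [u [w [Su utw /fass/eqP]]] := localization_ore Ss tq sq.
  rewrite rmorphB !rmorphM subr_eq0 => /eqP ux.
  apply: (ring_unit_cancel (funit u Su)); rewrite ux [LHS]mulrA -rmorphM utw.
  by rewrite rmorphM -mulrA (mulrA (f s)) uv mul1r.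
have gE r : g (sigma r) = f r.
  by have := gP (sigma r) 1 r; rewrite !rmorph1 !mul1r; apply.
have [p q||phi phiE] := @exists_rmorphism _ _ g.
- have [s [x [y [Ss sp sq]]]] := localization_common2 p q.
  apply: (ring_unit_cancel (funit s Ss)); rewrite mulrBr.
  rewrite (gP _ _ _ sp) (gP _ _ _ sq) -rmorphB; apply: gP => //.
  by rewrite mulrBr sp sq rmorphB.
- split=> [|p q]; first by rewrite -(rmorph1 sigma) gE rmorph1.
  have [s [x [Ss sp]]] := dense p.
  have [u [y [Su uxq]]] := dense (sigma x * q).
  have uspq : sigma (u * s) * (p * q) = sigma y.
    by rewrite rmorphM -!mulrA (mulrA (sigma s)) sp.
  apply: (ring_unit_cancel (funit _ (SM _ _ Su Ss))).
  rewrite (gP _ _ _ uspq) rmorphM -!mulrA.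
  rewrite (mulrA (f s)) (gP _ _ _ sp) mulrA -rmorphM; apply/esym.
  by apply: (gP q); rewrite rmorphM -mulrA.
by exists phi => r; rewrite phiE.
Qed.

End LocalizationTheory.

Lemma localization_unique (R Q Q' : pzRingType) (S : set R)
    (sigma : {rmorphism R -> Q}) (tau : {rmorphism R -> Q'}) :
  left_ore S -> is_left_localization S sigma -> is_left_localization S tau ->
  exists phi : {rmorphism Q -> Q'},
    bijective phi /\ forall r, phi (sigma r) = tau r.
Proof.
move=> oreS locs loct.
have [sunit sdense _] := locs; have [tunit tdense _] := loct.
have [phi phiE] := localization_universal oreS locs tunit.
have [psi psiE] := localization_universal oreS loct sunit.
exists phi; split=> //; exists psi => q.
  have [s [r [Ss sq]]] := sdense q.
  apply: (ring_unit_cancel (sunit s Ss)).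
  by rewrite -[in LHS]psiE -phiE -!rmorphM sq phiE psiE.
have [s [r [Ss sq]]] := tdense q.
apply: (ring_unit_cancel (tunit s Ss)).
by rewrite -[in LHS]phiE -psiE -!rmorphM sq psiE phiE.
Qed.

(** A ring A embedded in Q such that every element of Q is a left fraction over
    A satisfies the Ore condition automatically: it is obtained by writing
    the element r s^-1 of Q as a left fraction. *)
Lemma localization_at_units (A Q : pzRingType) (iota : {rmorphism A -> Q}) :
  injective iota -> (1 : A) != 0 ->
  (forall q, exists s r, ring_units Q (iota s) /\ iota s * q = iota r) ->
  left_denominator (iota @^-1` ring_units Q) /\
  is_left_localization (iota @^-1` ring_units Q) iota.
Proof.
move=> inj nz dense.
have iota0 x : iota x = 0 -> x = 0.
  by move=> x0; apply: inj; rewrite x0 rmorph0.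
set T := _ @^-1` _.
have T1 : T 1 by exists 1; rewrite rmorph1 mulr1.
split; last first.
  split=> // r; split=> [/iota0->|[s Ts sr0]]; first by exists 1; rewrite ?mulr0.
  by apply: (ring_unit_cancel Ts); rewrite -rmorphM sr0 rmorph0 mulr0.
split; last first.
  move=> r s Ts rs0; exists 1 => //; rewrite mul1r; apply: iota0.
  by apply: (ring_unit_cancelr Ts); rewrite -rmorphM rs0 rmorph0 mul0r.
split; first split=> // [s t [u [us su]] [v [vt tv]]|[v [_]]].
- exists (v * u); rewrite rmorphM; split.
    by rewrite -mulrA (mulrA u) us mul1r.
  by rewrite -mulrA (mulrA _ v) tv mul1r.
- by rewrite rmorph0 mul0r => /esym; rewrite -(rmorph1 iota) => /iota0/eqP; exact/negP.
move=> r s [v [vs sv]]; have [t [x [Tt tq]]] := dense (iota r * v).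
exists (t * r); split; first by exists t.
exists x => //; apply: inj; rewrite !rmorphM -tq.
by rewrite -!mulrA vs mulr1.
Qed.

(** * Localization at the left regular elements *)

Section LeftRegularLocalization.
Variable R : nzRingType.
Hypothesis udimR : finite_left_udim R.
Hypothesis regU :
  forall U : set R, uniform_left_ideal U -> left_regular_in U !=set0.

Local Notation C := (left_regular R).

Let essC (I : set R) : essential_left_ideal I -> I `&` C !=set0.
Proof. exact: essential_meets_left_regular. Qed.

(** For s in C, the left ideal Rs is essential, hence so is the left ideal of
    all t with tr in Rs, and any element of C in the latter proves the Ore
    condition. *)
Lemma left_regular_denominator : left_denominator C.
Proof.
have C1 : C 1 by move=> x; rewrite mulr1.
split; last first.
  by move=> r s Cs rs0; exists 1 => //; rewrite mul1r; exact: Cs.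
split; first split=> //.
- by move=> s t Cs Ct x; rewrite mulrA => /Ct/Cs.
- by move=> /(_ 1); rewrite mulr0 => /(_ erefl)/eqP; rewrite oner_eq0.
move=> r s Cs; have essRs := left_regular_essential udimR Cs.
have [|t [Rs Ct]] := essC (I := [set t | lprincipal s (t * r)]).
  apply: colon_essential; first exact: lideal_principal.
  move=> J hJ nzJ _; have [_ /(_ J hJ nzJ) [x [Rx Jx] x0]] := essRs.
  by exists x.
by have [x tr] := Rs; exists (t * r); split; [exists t | exists x].
Qed.

Let oreC : left_ore C. Proof. by case: left_regular_denominator. Qed.
Let lidA : left_ideal (ass C). Proof. by case: (ideal_ass oreC). Qed.

Lemma ass_left_regular_mul x c : C c -> ass C (x * c) -> ass C x.
Proof. by move=> Cc [s Cs]; rewrite mulrA => /Cc sx0; exists s. Qed.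

Lemma ass_left_regular_cancel c x : C c -> ass C (c * x) -> ass C x.
Proof.
move=> Cc [s Cs]; rewrite mulrA => scx; exists (s * c) => //.
by move=> y; rewrite mulrA => /Cc/Cs.
Qed.

(** If U contains a nonzero x of ass C, then Rx is essential in U, so for each
    u in U some c of C has cu in Rx, hence in ass C. *)
Lemma uniform_ass (U : set R) : uniform_left_ideal U ->
  U `<=` ass C \/ forall x, U x -> ass C x -> x = 0.
Proof.
move=> [hU _ uni].
have [[x Ux [ax x0]]|nx] :=
  pselect (exists2 x, U x & ass C x /\ x != 0); [left|right]; last first.
  move=> x Ux ax; apply/eqP; apply: contrapT => /negP x0.
  by apply: nx; exists x.
move=> u Uu.
have [|c [[r rx] Cc]] := essC (I := [set t | lprincipal x (t * u)]).
  apply: colon_essential => [|J hJ nzJ Ju]; first exact: lideal_principal.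
  apply: uni => //; first exact: lideal_principal.
  - by apply: (subset_trans Ju); exact: lprincipal_sub.
  - exact: lprincipal_sub.
  - exact: lprincipal_nonzero.
by apply: (ass_left_regular_cancel Cc); rewrite rx; exact: lidealM.
Qed.

Section Quotient.
Variables (Q : pzRingType) (sigma : {rmorphism R -> Q}).
Hypothesis locC : is_left_localization C sigma.

Let sunit s : C s -> ring_units Q (sigma s).
Proof. by case: locC => su _ _; exact: su. Qed.
Let dense q : exists s r, C s /\ sigma s * q = sigma r.
Proof. by case: locC. Qed.
Let ker r : sigma r = 0 <-> ass C r. Proof. by case: locC. Qed.

(** The preimage in R of an essential left ideal of Q is essential, so it meets
    C, whose elements become units. *)
Lemma localization_no_essential (K : set Q) : essential_left_ideal K -> K 1.
Proof.
move=> [hK essK].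
have [|c [Kc Cc]] := essC (I := sigma @^-1` K).
  split=> [|J hJ [j Jj j0]].
    split=> [|x y|r x] /=; first by rewrite rmorph0; exact: lideal0.
      by rewrite rmorphB; exact: lidealB.
    by rewrite rmorphM; exact: lidealM.
  have [sj0|sj0] := eqVneq (sigma j) 0.
    by exists j => //; split=> //=; rewrite sj0; exact: lideal0.
  have [z [Kqj [q zE]] qj0] :=
    essK _ (lideal_principal (sigma j)) (lprincipal_nonzero sj0).
  rewrite {z}zE in Kqj qj0; have [s [r [Cs sq]]] := dense q.
  exists (r * j); last first.
    apply: contra_neq qj0 => rj0; apply: (ring_unit_cancel (sunit Cs)).
    by rewrite mulrA sq -rmorphM rj0 rmorph0 mulr0.
  split; last exact: lidealM.
  by rewrite /= rmorphM -sq -mulrA; exact: lidealM.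
have [v [vc _]] := sunit Cc.
by rewrite -vc; exact: lidealM.
Qed.

(** The left ideal of Q generated by the image of U, in the form provided by
    common denominators. *)
Definition extension (U : set R) : set Q :=
  [set q | exists s u, [/\ C s, U u & sigma s * q = sigma u]].

Lemma lideal_extension U : left_ideal U -> left_ideal (extension U).
Proof.
move=> hU; split.
- by exists 1, 0; split; [case: oreC => -[]|exact: lideal0|rewrite mulr0 rmorph0].
- move=> p q [s [u [Cs Uu su]]] [t [v [Ct Uv tv]]].
  have [w [y [Cw Cws wy]]] := ore_common oreC Cs Ct.
  exists (w * s), (w * u - y * v); split=> //.
    by apply: lidealB => //; exact: lidealM.
  by rewrite mulrBr {2}wy !rmorphM -!mulrA su tv rmorphB !rmorphM.
- move=> p q [s [u [Cs Uu su]]].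
  have [v [vs _]] := sunit Cs; have [t [r [Ct tr]]] := dense (p * v).
  exists t, (r * u); split=> //; first exact: lidealM.
  by rewrite rmorphM -tr -su -!mulrA (mulrA v) vs mul1r.
Qed.

Lemma extension_ass U : U `<=` ass C -> left_ideal U -> extension U = [set 0].
Proof.
move=> Ua hU; apply/seteqP; split=> [q [s [u [Cs /Ua/ker u0 su]]]|_ ->].
  by apply: (ring_unit_cancel (sunit Cs)); rewrite su u0 mulr0.
by apply: lideal0; exact: lideal_extension.
Qed.

Lemma uniform_extension U : uniform_left_ideal U ->
  (forall x, U x -> ass C x -> x = 0) -> uniform_left_ideal (extension U).
Proof.
move=> unifU U0; have [hU [u Uu u0] uni] := unifU.
have C1 : C 1 by case: oreC => -[].
split; first exact: lideal_extension.
  exists (sigma u); first by exists 1, u; rewrite rmorph1 mul1r.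
  by apply: contra_neq u0 => /ker; exact: U0.
have pick K : left_ideal K -> K `<=` extension U -> nonzero_set K ->
    exists x, [/\ U x, x != 0 & K (sigma x)].
  move=> hK KU [q Kq q0]; have [s [x [Cs Ux sq]]] := KU q Kq.
  exists x; split=> //; last by rewrite -sq; exact: lidealM.
  apply: contra_neq q0 => x0; apply: (ring_unit_cancel (sunit Cs)).
  by rewrite sq x0 rmorph0 mulr0.
move=> J K hJ hK JU KU nzJ nzK.
have [x [Ux x0 Jx]] := pick J hJ JU nzJ.
have [y [Uy y0 Ky]] := pick K hK KU nzK.
have [||||||z [[r zr] [t zt]] z0] := uni (lprincipal x) (lprincipal y).
- exact: lideal_principal.
- exact: lideal_principal.
- exact: lprincipal_sub.
- exact: lprincipal_sub.
- exact: lprincipal_nonzero.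
- exact: lprincipal_nonzero.
exists (sigma z); first split.
- by rewrite zr rmorphM; exact: lidealM.
- by rewrite zt rmorphM; exact: lidealM.
- apply: contra_neq z0 => /ker; apply: U0.
  by rewrite zr; exact: lidealM.
Qed.

Lemma extension_common n (U : 'I_n -> set R) (q : 'I_n -> Q) :
  (forall i, left_ideal (U i)) -> (forall i, extension (U i) (q i)) ->
  exists s (u : 'I_n -> R),
    [/\ C s, forall i, U i (u i) & forall i, sigma s * q i = sigma (u i)].
Proof.
move=> hU Uq.
suff [s Cs /choice[u uP]] : exists2 s, C s & forall i, exists u,
    i \in enum 'I_n -> U i u /\ sigma s * q i = sigma u.
  by exists s, u; split=> // i; have [] := uP i (mem_enum _ i).
elim: (enum 'I_n) => [|i l [s Cs IH]].
  by exists 1 => [|i]; [case: oreC => -[] | exists 0].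
have [t [v [Ct Uv tv]]] := Uq i.
have [w [y [Cw Cws wy]]] := ore_common oreC Cs Ct.
exists (w * s) => // j; have [->|ji] := eqVneq j i.
  exists (y * v) => _; split; first exact: lidealM.
  by rewrite wy !rmorphM -mulrA tv.
have [u uP] := IH j; exists (w * u).
rewrite inE (negPf ji) => /uP[Uu su]; split; first exact: lidealM.
by rewrite !rmorphM -mulrA su.
Qed.

(** Extend to Q the uniform left ideals U_i of R.  Directness survives because a
    relation in Q becomes, after a common denominator, a relation in R
    modulo ass C, which an element of C clears.  The sum of the extensions is
    all of Q, as the sum of the U_i contains an element of C. *)
Lemma localization_udim : finite_left_udim Q.
Proof.
have [n [U [unifU dirU essU]]] := udimR.
have hU i : left_ideal (U i) by case: (unifU i).
have hE i : left_ideal (extension (U i)) by exact: lideal_extension.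
apply: (@udim_of_uniform_or_zero _ n (fun i => extension (U i))).
- move=> i; have [Ua|U0] := uniform_ass (unifU i).
    by right; exact: extension_ass.
  by left; exact: uniform_extension.
- move=> q Uq q0 i; have [s [u [Cs Uu su]]] := extension_common hU Uq.
  have /ker[c Cc cu0] : sigma (\sum_i u i) = 0.
    rewrite raddf_sum (eq_bigr (fun i => sigma s * q i)) => [|j _].
      by rewrite -mulr_sumr q0 mulr0.
    by rewrite su.
  apply: (ring_unit_cancel (sunit Cs)); rewrite su mulr0; apply/ker.
  exists c => //; apply: (dirU (fun j => c * u j)) => [j|].
    exact: lidealM.
  by rewrite -mulr_sumr.
have [c [[u Uu cE] Cc]] := essC essU; have [v [vc _]] := sunit Cc.
have S1 : sum_left_ideals (fun i => extension (U i)) 1.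
  exists (fun i => v * sigma (u i)) => [i|].
    apply: lidealM => //; exists 1, (u i).
    by rewrite rmorph1 mul1r; split=> //; case: oreC => -[].
  by rewrite -mulr_sumr -raddf_sum -cE vc.
split; first exact: lideal_sumI.
move=> J hJ [x Jx x0]; exists x => //; split=> //.
by rewrite -[x]mulr1; apply: lidealM => //; exact: lideal_sumI.
Qed.

Lemma localization_semisimple_artinian : semisimple_artinian Q.
Proof.
apply: no_essential_semisimple_artinian; first exact: localization_udim.
exact: localization_no_essential.
Qed.

Lemma localization_left_regular_unit q : left_regular Q q -> ring_units Q q.
Proof.
apply: no_essential_left_regular_unit; first exact: localization_udim.
exact: localization_no_essential.
Qed.

Lemma left_regular_units :
  C = sigma @^-1` ring_units Q `&` left_regular_on (ass C).
Proof.
apply/seteqP; split=> [c Cc|c [cu cinj] x xc0].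
  split; first exact: sunit.
  move=> x y _ _ /eqP; rewrite -subr_eq0 -mulrBl => /eqP/Cc/eqP.
  by rewrite subr_eq0 => /eqP.
have ax : ass C x.
  apply/ker; apply: (ring_unit_cancelr cu).
  by rewrite -rmorphM xc0 rmorph0 mul0r.
by apply: cinj; rewrite ?inE ?mul0r//; exact: lideal0.
Qed.

(** A left regular element of R/a stays left regular in Q, since denominators
    can be cleared, and is therefore a unit of Q.  Units of Q lying in R/a are
    regular because R/a embeds in Q. *)
Lemma quotient_embedding (ha : ideal (ass C)) :
  exists iota : {rmorphism quotient_ring ha -> Q},
    [/\ injective iota, forall r, iota (quotient_proj ha r) = sigma r,
        left_regular (quotient_ring ha) = regular (quotient_ring ha)
      & regular (quotient_ring ha) = iota @^-1` ring_units Q].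
Proof.
have [|iota iotaE] := quotient_rmorphism ha (f := sigma).
  by move=> x /ker.
have iota0 x : iota x = 0 -> x = 0.
  have [r ->] := quotient_proj_surj x; rewrite iotaE => /ker ar.
  rewrite -(rmorph0 (quotient_proj ha)); apply/quotient_projP.
  by rewrite subr0.
have inj : injective iota.
  move=> x y /eqP; rewrite -subr_eq0 -rmorphB => /eqP/iota0/eqP.
  by rewrite subr_eq0 => /eqP.
have reg_unit : left_regular (quotient_ring ha) `<=` iota @^-1` ring_units Q.
  move=> c creg; apply: localization_left_regular_unit => q qc0.
  have [s [r [Cs sq]]] := dense q.
  apply: (ring_unit_cancel (sunit Cs)); rewrite mulr0 sq -iotaE.
  rewrite (creg (quotient_proj ha r)) ?rmorph0//; apply: inj.
  by rewrite rmorphM iotaE -sq -mulrA qc0 mulr0 rmorph0.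
have unit_reg : iota @^-1` ring_units Q `<=` regular (quotient_ring ha).
  move=> c cu; split=> x /(congr1 iota); rewrite rmorphM rmorph0 => xc0;
    apply: iota0.
    by apply: (ring_unit_cancelr cu); rewrite xc0 mul0r.
  by apply: (ring_unit_cancel cu); rewrite xc0 mulr0.
have reg_left : regular (quotient_ring ha) `<=` left_regular (quotient_ring ha).
  by move=> c [].
exists iota; split=> //; apply/seteqP; split=> //.
  exact: subset_trans unit_reg.
exact: subset_trans reg_unit.
Qed.

(** Since the regular elements of R/a are exactly those invertible in Q, the
    ring Q is the classical left quotient ring of R/a as well. *)
Lemma quotient_localization (ha : ideal (ass C))
    (iota : {rmorphism quotient_ring ha -> Q}) :
  injective iota -> (forall r, iota (quotient_proj ha r) = sigma r) ->
  regular (quotient_ring ha) = iota @^-1` ring_units Q ->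
  left_denominator (regular (quotient_ring ha)) /\
  is_left_localization (regular (quotient_ring ha)) iota.
Proof.
move=> inj iotaE ->; apply: localization_at_units => // [|q].
  apply/eqP; rewrite -(rmorph1 (quotient_proj ha)) -(rmorph0 (quotient_proj ha)).
  move=> /quotient_projP; rewrite subr0 => -[s Cs].
  by rewrite mulr1 => s0; case: oreC => -[_ _]; rewrite -s0.
have [s [r [Cs sq]]] := dense q.
exists (quotient_proj ha s), (quotient_proj ha r); rewrite !iotaE.
by split=> //; exact: sunit.
Qed.

End Quotient.

Lemma left_regular_quotient (ha : ideal (ass C)) :
  C = quotient_proj ha @^-1` left_regular (quotient_ring ha)
        `&` left_regular_on (ass C).
Proof.
have proj0 x : quotient_proj ha x = 0 <-> ass C x.
  rewrite -(rmorph0 (quotient_proj ha)) -[in ass C x](subr0 x).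
  exact: quotient_projP.
apply/seteqP; split=> [c Cc|c [creg cinj] x xc0].
  split=> [y|x y _ _ /eqP].
    have [r ->] := quotient_proj_surj y.
    by rewrite -(rmorphM (quotient_proj ha)) => /proj0/(ass_left_regular_mul Cc)/proj0.
  by rewrite -subr_eq0 -mulrBl => /eqP/Cc/eqP; rewrite subr_eq0 => /eqP.
have ax : ass C x.
  by apply/proj0/creg; rewrite -(rmorphM (quotient_proj ha)) xc0 rmorph0.
by apply: cinj; rewrite ?inE ?mul0r//; exact: lideal0.
Qed.

(** Let JK annihilate U modulo ass C while K does not.  Then the left ideal V of
    all v in U with Jv inside ass C is nonzero, hence uniform, and some v0 in V
    acts injectively on V; it does so on U, because V is essential in U.
    For j in J and u in U the element (ju) v0 lies in ass C and in U, so it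
    vanishes, and therefore ju = 0. *)
Lemma prime_uniform_ann (U : set R) : uniform_left_ideal U ->
  (forall x, U x -> ass C x -> x = 0) ->
  prime_ideal [set r | forall u, U u -> ass C (r * u)].
Proof.
move=> unifU U0; have [hU [u1 Uu1 u10] uni] := unifU; split.
- split; first split=> [u _|r s Pr Ps u Uu|s r Pr u Uu].
  + by rewrite mul0r; exact: lideal0.
  + by rewrite mulrBl; apply: lidealB; [|exact: Pr|exact: Ps].
  + by rewrite -mulrA; apply: lidealM => //; exact: Pr.
  by move=> s r Pr u Uu; rewrite -mulrA; apply: Pr; exact: lidealM.
- move=> /(_ u1 Uu1); rewrite mul1r => /(U0 _ Uu1) u1E.
  by rewrite u1E eqxx in u10.
move=> J K [hJ Jr] [hK _] JK.
set P := [set r | _]; have [KP|nKP] := pselect (K `<=` P); [by right|left].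
pose V := [set v | U v /\ forall j, J j -> ass C (j * v)].
have hV : left_ideal V.
  split=> [|v w [Uv Jv] [Uw Jw]|r v [Uv Jv]].
  - by split=> [|j _]; [exact: lideal0 | rewrite mulr0; exact: lideal0].
  - split=> [|j Jj]; first exact: lidealB.
    by rewrite mulrBr; apply: lidealB; [|exact: Jv|exact: Jw].
  - split=> [|j Jj]; first exact: lidealM.
    by rewrite mulrA; apply: Jv; exact: Jr.
have VU : V `<=` U by move=> v [].
have nzV : nonzero_set V.
  apply: contrapT => nz; apply: nKP => k Kk u Uu.
  suff -> : k * u = 0 by exact: lideal0.
  apply: (not_nonzeroP nz); split=> [|j Jj]; first exact: lidealM.
  by rewrite mulrA; exact: JK.
have unifV : uniform_left_ideal V.
  split=> // I L hI hL IV LV; apply: uni => //; exact: subset_trans VU.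
have [v0 [[Uv0 Jv0] vinj]] := regU unifV.
have v0reg w : U w -> w * v0 = 0 -> w = 0.
  move=> Uw wv0; apply: contrapT => /eqP w0.
  have [| | | | | |y [[Uy yv0] Vy] y0] := uni (U `&` lann v0) V.
  - by apply: lideal_setI => //; exact: lideal_ann.
  - exact: hV.
  - by move=> y [].
  - exact: VU.
  - by exists w.
  - exact: nzV.
  case/eqP: y0; apply: vinj; rewrite ?inE ?mul0r//; exact: lideal0.
move=> j Jj u Uu; suff -> : j * u = 0 by exact: lideal0.
apply: v0reg; first exact: lidealM.
by apply: U0; [exact: lidealM | apply: Jv0; exact: Jr].
Qed.

Lemma prime_radical_ass : prime_radical R `<=` ass C.
Proof.
move=> x xrad; have [n [U [unifU dirU essU]]] := udimR.
have [c [[u Uu cE] Cc]] := essC essU.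
apply: (ass_left_regular_mul Cc); rewrite cE mulr_sumr.
apply: lideal_sum => // i _; have [Ua|U0] := uniform_ass (unifU i).
  by apply: lidealM => //; exact: Ua.
exact: (xrad _ (prime_uniform_ann (unifU i) U0)).
Qed.

End LeftRegularLocalization.

Theorem theorem2p3 (R : nzRingType)
    (udimR : finite_left_udim R)
    (regU : forall U : set R, uniform_left_ideal U ->
       left_regular_in U !=set0) :
  let C := left_regular R in
  let a := ass C in
  Den_l a C /\
  (exists ha : ideal a,
     let Rbar : pzRingType := quotient_ring ha in
     let pi : {rmorphism R -> Rbar} := @quotient_proj R a ha in
     (* existence of 'Q and of Q_{l,cl}(R/a) *)
     [/\ exists (Q : pzRingType) (sigma : {rmorphism R -> Q}),
           is_left_localization C sigma,
         left_denominator (regular Rbar),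
         exists (Qcl : pzRingType) (tau : {rmorphism Rbar -> Qcl}),
           is_left_localization (regular Rbar) tau
       & forall (Q : pzRingType) (sigma : {rmorphism R -> Q}),
           is_left_localization C sigma ->
         [/\ (* 1 *)
             semisimple_artinian Q,
             (* 2 *)
             forall (Qcl : pzRingType) (tau : {rmorphism Rbar -> Qcl}),
               is_left_localization (regular Rbar) tau ->
               exists phi : {rmorphism Q -> Qcl}, bijective phi /\
                 forall r q, phi (sigma r * q) = tau (pi r) * phi q,
             (* 3(a) *)
             [/\ C = pi @^-1` left_regular Rbar `&` left_regular_on a,
                 C = [set c | injective (fun y : Rbar => y * pi c) /\
                              set_inj a (fun y => y * c)]
               & C = sigma @^-1` ring_units Q `&` left_regular_on a]
           & (* 3(b); iota is the inclusion of R/a in 'Q *)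
             exists iota : {rmorphism Rbar -> Q},
               [/\ injective iota, forall r, iota (pi r) = sigma r,
                   left_regular Rbar = regular Rbar
                 & regular Rbar = iota @^-1` ring_units Q]]]) /\
  (* 4 *)
  (forall I : set R, essential_left_ideal I -> I `&` C !=set0) /\
  (* 5 *)
  prime_radical R `<=` a.
Proof.
move=> C a; have denC : left_denominator C := left_regular_denominator udimR regU.
have oreC : left_ore C by case: denC.
split; first by [].
split; last first.
  split=> [I|]; first exact: essential_meets_left_regular.
  exact: prime_radical_ass.
exists (ideal_ass oreC); set ha := ideal_ass oreC => Rbar pi.
have locQ := ore_localizationP denC.
have [iota0 [inj0 iota0E _ reg0]] := quotient_embedding udimR regU locQ ha.
have [denR locR] := quotient_localization udimR regU locQ inj0 iota0E reg0.
split=> //.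
- by exists (ore_localization denC), (fraction_scalar denC).
- by exists (ore_localization denC), iota0.
move=> Q sigma locsigma.
have [iota [inj iotaE reg_eq reg]] := quotient_embedding udimR regU locsigma ha.
have C3a := left_regular_quotient udimR regU ha.
split.
- exact: localization_semisimple_artinian udimR regU _ _ locsigma.
- move=> Qcl tau loctau.
  have [_ lociota] := quotient_localization udimR regU locsigma inj iotaE reg.
  have oreR : left_ore (regular Rbar) by case: denR.
  have [phi [bij phiE]] := localization_unique oreR lociota loctau.
  by exists phi; split=> // r q; rewrite rmorphM -iotaE phiE.
- split=> //; last exact: left_regular_units.
  apply: (eq_trans C3a); apply/seteqP; split=> c [creg cinj]; split=> //.
    move=> y z /eqP; rewrite -subr_eq0 -mulrBl => /eqP/creg/eqP.
    by rewrite subr_eq0 => /eqP.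
  by move=> y yc0; apply: creg; rewrite yc0 mul0r.
- by exists iota.
Qed.
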